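(* Let $G=\langle s_1,\ldots,s_r\rangle$ be a free group of rank $r$ with $2\le r<\infty$, freely generated by $s_1,\dots,s_r$, let $\mu$ be the uniform probability measure on $\{s_1,\ldots,s_r,s_1^{-1},\ldots,s_r^{-1}\}$, and let $h_{max}(\mu)$ denote the maximum value of the $\mu$-entropy $h_\mu(X,\eta)$ over all $\mu$-stationary $G$-actions $(X,\eta)$. Then for every $t\in[0,h_{max}(\mu)]$ there exists an ergodic $\mu$-stationary $G$-action on a probability space $(X,\eta)$ with $h_\mu(X,\eta)=t$.
   Context: Let $\mu$ be a probability measure on a countable group $G$. An action of $G$ on a probability space $(X,\eta)$ is $\mu$-stationary if $\eta=\mu*\eta$, where $\mu*\eta:=\int g_*\eta\,d\mu(g)$. The Furstenberg entropy (or $\mu$-entropy) of a $\mu$-stationary action on $(X,\eta)$ is $$h_\mu(X,\eta):=\iint -\log\frac{d\eta\circ g}{d\eta}(x)\,d\eta(x)\,d\mu(g),$$ where $\eta\circ g(E)=\eta(gE)$. *)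

(* Defs.v *)
From HB Require Import structures.
From mathcomp Require Import all_boot all_order all_algebra.
From mathcomp Require Import all_classical all_reals all_analysis.

Set Implicit Arguments.
Unset Strict Implicit.
Unset Printing Implicit Defensive.

Import Order.TTheory GRing.Theory Num.Theory.
Import numFieldNormedType.Exports.

Local Open Scope classical_set_scope.
Local Open Scope ring_scope.

(* A word is a sequence of letters (i, b), with (i, false) standing for the
   generator s i and (i, true) for its inverse. *)
Section FreeGeneration.
Local Open Scope group_scope.
Variables (G : groupType) (r : nat) (s : 'I_r -> G).

Definition letter (l : 'I_r * bool) : G :=
  if l.2 then (s l.1)^-1 else s l.1.

Definition word_value (w : seq ('I_r * bool)) : G :=
  foldr (fun l g => letter l * g) 1 w.

Definition reduced (w : seq ('I_r * bool)) : bool :=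
  sorted (fun k l => l != (k.1, ~~ k.2)) w.

Definition freely_generates : Prop :=
  forall g : G, exists! w, reduced w /\ word_value w = g.

Definition generators_and_inverses : set G :=
  range s `|` range (fun i => (s i)^-1).

End FreeGeneration.

(* G with all its subsets measurable, as is usual for a countable group. *)
Definition discrete_group (G : groupType) : Type := G.

Section DiscreteGroup.
Variable G : groupType.
HB.instance Definition _ := Choice.on (discrete_group G).
HB.instance Definition _ := isPointed.Build (discrete_group G) (1%g : G).
HB.instance Definition _ := @isMeasurable.Build default_measure_display
  (discrete_group G) (@discrete_measurable G) (@discrete_measurable0 G)
  (@discrete_measurableC G) (@discrete_measurableU G).

Lemma measurable_discrete_group (A : set (discrete_group G)) : measurable A.
Proof. by []. Qed.

End DiscreteGroup.

(* The second argument of mnormalize is only the default value used when the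
   measure cannot be normalized, i.e., when A is empty or infinite. *)
Definition uniform_on (R : realType) (G : groupType)
    (A : set (discrete_group G)) : probability (discrete_group G) R :=
  mnormalize (mrestr (@counting (discrete_group G) R)
                     (measurable_discrete_group A))
             (\d_(1%g : discrete_group G)).

Record measurable_action (G : groupType) (d : measure_display)
    (X : measurableType d) := MeasurableAction {
  act :> G -> X -> X;
  act1 : forall x, act 1%g x = x;
  actM : forall g h x, act (g * h)%g x = act g (act h x);
  measurable_act : forall g, measurable_fun setT (act g) }.

Section TranslatedMeasure.
Context (R : realType) (G : groupType) (d : measure_display)
  (X : measurableType d).
Variables (a : measurable_action G X) (eta : probability X R) (g : G).
Local Open Scope ereal_scope.

Definition translate : set X -> \bar R := fun E => eta (a g @` E).

Lemma act_image (E : set X) : a g @` E = a (g^-1)%g @^-1` E.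
Proof.
apply/seteqP; split => [_ [x Ex <-]|x Ex] /=.
  by rewrite -actM mulVg act1.
by exists (a (g^-1)%g x) => //; rewrite -actM mulgV act1.
Qed.

Let translateE : translate = pushforward eta (a (g^-1)%g).
Proof. by apply/funext => E; rewrite /translate act_image. Qed.

Let translate0 : translate set0 = 0.
Proof. by rewrite /translate image_set0 measure0. Qed.

Let translate_ge0 E : 0 <= translate E.
Proof. exact: measure_ge0. Qed.

Let translate_sigma_additive : semi_sigma_additive translate.
Proof.
move=> F mF tF _; rewrite translateE /pushforward preimage_bigcup.
have mpF n : measurable (a (g^-1)%g @^-1` F n).
  by rewrite -[X in measurable X]setTI; exact: measurable_act.
apply: measure_semi_sigma_additive => //; last exact: bigcup_measurable.
apply/trivIsetP => /= i j _ _ ij; rewrite -preimage_setI.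
by move/trivIsetP : tF => /(_ _ _ _ _ ij) ->//; rewrite preimage_set0.
Qed.

HB.instance Definition _ := isMeasure.Build _ _ _ translate
  translate0 translate_ge0 translate_sigma_additive.

Let translate_finite : fin_num_fun translate.
Proof.
move=> E mE; rewrite translateE; apply: fin_num_measure.
by rewrite -[X in measurable X]setTI; exact: measurable_act.
Qed.

HB.instance Definition _ := Measure_isFinite.Build _ _ _ translate
  translate_finite.

End TranslatedMeasure.

Section Stationary.
Context (R : realType) (G : groupType) (d : measure_display)
  (X : measurableType d).
Variables (mu : probability (discrete_group G) R)
  (a : measurable_action G X) (eta : probability X R).
Local Open Scope ereal_scope.

Definition convolution (E : set X) : \bar R :=
  \int[mu]_g pushforward eta (a g) E.

Definition stationary : Prop :=
  forall E, measurable E -> eta E = convolution E.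

Definition ergodic : Prop :=
  forall E, measurable E -> (forall g, a g @` E = E) ->
    eta E = 0 \/ eta E = 1.

(* If eta is mu-stationary and the support of mu is closed under inversion,
   then translate a eta g is absolutely continuous w.r.t. eta for every g in
   the support, so that the derivatives below are meaningful. *)
Definition furstenberg_entropy : \bar R :=
  \int[mu]_g \int[eta]_x
    - lne (Radon_Nikodym (charge_of_finite_measure (translate a eta g)) eta x).

End Stationary.

Definition is_max_entropy (R : realType) (G : groupType)
    (mu : probability (discrete_group G) R) (h : \bar R) : Prop :=
  (exists (d : measure_display) (X : measurableType d)
      (a : measurable_action G X) (eta : probability X R),
    stationary mu a eta /\ furstenberg_entropy mu a eta = h) /\
  (forall (d : measure_display) (X : measurableType d)
      (a : measurable_action G X) (eta : probability X R),
    stationary mu a eta -> (furstenberg_entropy mu a eta <= h)%E).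

(* Main.v *)
(* Write [q = 2 r - 1].  Stationarity says that the densities
   [f_l = d (eta o l) / d eta] of the [q + 1] letters sum to [q + 1], and it
   forces [1 / q <= f_l <= q].  By change of variables, the integral of
   [- ln f_k], for [k] the inverse letter of [l], is that of [f_l ln f_l].  So
   the entropy is the average of the integrals of [(f_l - 1) ln f_l / 2], and [(c - 1) ln c <= (q - 1) / (q + 1) ln q (c + 1)]
   on [[1 / q, q]] bounds it by [hmax = (q - 1) / (q + 1) ln q].

   Conversely, freeness lets the generators act by arbitrary nonsingular
   bijections, and both stationarity and entropy only depend on the laws of the
   densities.  On finitely many copies of the unit interval, letters that are
   piecewise affine in base [q] realize any prescribed combinatorics of
   densities.  Ergodicity then comes from the maximum principle for the measures
   of an invariant set in the copies, and from its uniform distribution in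
   [q]-adic intervals.  One copy per letter gives [hmax].  A cyclic chain of
   [M + 1] levels, along which the densities follow a harmonic function on the
   tree, gives entropies tending to [hmax]; one level is fixed pointwise by some
   letters, and letting these rotate a tower of [n] more floors over a part of
   relative measure [delta] of that level divides the entropy by a factor that
   takes every value in [[1, +oo[]. *)

Require Import Defs.
From HB Require Import structures.
From mathcomp Require Import all_boot all_order all_algebra.
From mathcomp Require Import all_classical all_reals all_analysis.
From mathcomp Require Import measurable_realfun finmap ring lra zify.

Set Implicit Arguments.
Unset Strict Implicit.
Unset Printing Implicit Defensive.

Import Order.TTheory GRing.Theory Num.Theory.
Import numFieldNormedType.Exports.

Local Open Scope classical_set_scope.
Local Open Scope ring_scope.

(** * Words and actions of the free group *)

Definition inv_letter (r : nat) (l : 'I_r * bool) : 'I_r * bool := (l.1, ~~ l.2).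

Lemma inv_letterK (r : nat) : involutive (@inv_letter r).
Proof. by move=> [i b]; rewrite /inv_letter /= negbK. Qed.

Lemma inv_letter_neq (r : nat) (l : 'I_r * bool) : inv_letter l != l.
Proof. by case: l => i []; rewrite /inv_letter /= xpair_eqE andbF. Qed.

Section FreeLetters.
Local Open Scope group_scope.
Context (G : groupType) (r : nat) (s : 'I_r -> G).
Local Notation L := ('I_r * bool)%type.

Lemma letter_inv (l : L) : letter s (inv_letter l) = (letter s l)^-1.
Proof. by case: l => i []; rewrite /letter /inv_letter //= invgK. Qed.

Hypothesis hs : freely_generates s.

Lemma letter_inj : injective (letter s).
Proof.
move=> k l kl; have [w [_ uw]] := hs (letter s k).
have wk : w = [:: k] by apply: uw; rewrite /word_value /= mulg1.
have : w = [:: l] by apply: uw; rewrite /word_value /= mulg1 kl.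
by rewrite wk => -[].
Qed.

Definition reduced_word (g : G) : seq L := sval (cid (hs g)).

Lemma reduced_wordP (g : G) :
  reduced (reduced_word g) /\ word_value s (reduced_word g) = g.
Proof. by rewrite /reduced_word; case: cid => w []. Qed.

Lemma reduced_word_uniq (w : seq L) :
  reduced w -> reduced_word (word_value s w) = w.
Proof. by move=> rw; rewrite /reduced_word; case: cid => v [_ u] /=; exact: u. Qed.

Section FreeAction.
Context (X : Type) (T : L -> X -> X).
Hypothesis TK : forall l, cancel (T l) (T (inv_letter l)).

Definition free_act (g : G) (x : X) : X := foldr T x (reduced_word g).

Lemma free_act1 x : free_act 1 x = x.
Proof. by rewrite /free_act (@reduced_word_uniq [::]). Qed.

(** If the reduced word of [g] does not begin with the inverse of [l], prefixing [l] keeps it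
    reduced. Otherwise the two letters cancel, and [TK] cancels the corresponding maps. *)
Lemma free_act_letterM l g x :
  free_act (letter s l * g) x = T l (free_act g x).
Proof.
rewrite /free_act; have [rw <-] := reduced_wordP g.
move: (reduced_word g) rw => w rw; rewrite (reduced_word_uniq rw).
have [/(@reduced_word_uniq (l :: w)) -> //|] := boolP (reduced (l :: w)).
case: w rw => [//|k w] rw.
rewrite /reduced /=; move: (rw); rewrite /reduced /= => ->.
rewrite andbT negbK => /eqP kl.
have -> : letter s l * word_value s (k :: w) = word_value s w.
  by rewrite {}kl /= (letter_inv l) mulVKg.
have /reduced_word_uniq -> /= : reduced w.
  by move: rw; rewrite /reduced /=; case: w => //= k' w /andP[].
by rewrite kl -[X in T X (T _ _)](inv_letterK l) TK.
Qed.

Lemma free_act_letter l x : free_act (letter s l) x = T l x.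
Proof. by rewrite -[letter s l]mulg1 free_act_letterM free_act1. Qed.

Lemma free_actM g h x : free_act (g * h) x = free_act g (free_act h x).
Proof.
have [_ <-] := reduced_wordP g; elim: (reduced_word g) => [|l w IH] /=.
  by rewrite mul1g free_act1.
by rewrite -mulgA !free_act_letterM IH.
Qed.

Lemma free_act_ind (P : (X -> X) -> Prop) : P id ->
  (forall l f, P f -> P (T l \o f)) -> forall g, P (free_act g).
Proof.
move=> P1 PT g; rewrite /free_act.
elim: (reduced_word g) => [|l w IH] /=; first exact: P1.
exact: PT l _ IH.
Qed.

End FreeAction.

Section FreeMeasurableAction.
Context (d : measure_display) (X : measurableType d) (T : L -> X -> X).
Hypotheses (TK : forall l, cancel (T l) (T (inv_letter l)))
  (mT : forall l, measurable_fun setT (T l)).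

Lemma measurable_free_act g : measurable_fun setT (free_act T g).
Proof.
apply: (@free_act_ind X T (fun f => measurable_fun setT (f : X -> X))).
  exact: measurable_id.
by move=> l f mf; apply: measurableT_comp.
Qed.

Definition free_action : measurable_action G X :=
  MeasurableAction (free_act1 T) (free_actM TK) measurable_free_act.

End FreeMeasurableAction.
End FreeLetters.

(** * Integration against the uniform measure on the letters *)

Section UniformIntegral.
Context (R : realType) (G : groupType) (r : nat) (s : 'I_r -> G).
Local Notation L := ('I_r * bool)%type.
Hypotheses (r_gt0 : (0 < r)%N) (hs : freely_generates s).
Local Notation mu := (@uniform_on R G (generators_and_inverses s)).

Lemma generators_and_inversesE : generators_and_inverses s = range (letter s).
Proof.
apply/seteqP; split=> g.
  by move=> [] [i _ <-]; [exists (i, false)|exists (i, true)].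
by move=> [[i []] _ <-]; [right|left]; exists i.
Qed.

Lemma uniform_onE (A : set (discrete_group G)) :
  mu A = (counting (A `&` range (letter s)) * (r * 2)%:R^-1%:E)%E.
Proof.
have mE B : mrestr (@counting (discrete_group G) R)
    (measurable_discrete_group (generators_and_inverses s)) B =
  counting (B `&` range (letter s)) by rewrite -generators_and_inversesE.
rewrite /uniform_on /= /mnormalize /= !mE (@setTI (discrete_group G)).
(* Freeness makes the letters distinct, so the normalizing constant is exactly [r * 2]. *)
suff -> : @counting (discrete_group G) R (range (letter s)) = (r * 2)%:R%:E.
  by rewrite eqe pnatr_eq0 muln_eq0 eqn0Ngt r_gt0 /= mE.
have -> : range (letter s) = [set` (letter s @` [fset l in enum {: L}])%fset].
  apply/seteqP; split=> g /=.
    by move=> [l _ <-]; apply/imfsetP; exists l => //=; rewrite inE mem_enum.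
  by move=> /imfsetP [l /= _ ->]; exists l.
rewrite /counting asboolT; last exact: finite_fset.
rewrite set_fsetK card_imfset /=; last exact: letter_inj.
by rewrite card_fseq undup_id ?enum_uniq // -cardE card_prod card_ord card_bool.
Qed.

Lemma uniform_on_letter (l : L) :
  mu [set (letter s l : discrete_group G)] = (r * 2)%:R^-1%:E.
Proof.
rewrite uniform_onE (_ : _ `&` _ = [set letter s l]); last first.
  by apply/setIidl => _ ->; exists l.
rewrite /counting asboolT; last exact: finite_set1.
by rewrite fset_set1 cardfs1 mul1e.
Qed.

Lemma integral_uniform_on (F : discrete_group G -> \bar R) (c : L -> R) :
  (forall l, F (letter s l) = (c l)%:E) ->
  (\int[mu]_g F g = ((r * 2)%:R^-1 * \sum_l c l)%:E)%E.
Proof.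
move=> Fc; pose F1 l (g : discrete_group G) : \bar R :=
  ((c l)%:E * (\1_[set (letter s l : discrete_group G)] g)%:E)%E.
have iF1 l : mu.-integrable setT (F1 l).
  by apply: integrableZl => //; exact: integrable_indic.
(* [F] is arbitrary away from the letters, but these have full measure: up to a null set [F] is a
   finite combination of indicators. *)
rewrite (ae_eq_integral (fun g => \sum_l F1 l g)%E) //=.
- rewrite integral_sum // mulr_sumr -sumEFin; apply: eq_bigr => l _.
  rewrite /F1 integralZl //; last exact: integrable_indic.
  rewrite integral_indic // setIT [X in (_ * X)%E](uniform_on_letter l).
  by rewrite -EFinM mulrC.
- exists (~` range (letter s)); split => //.
    apply: (etrans (uniform_onE _)).
    by rewrite setICl /counting asboolT // fset_set0 mul0e.
  move=> g /= nP [l _ gl]; apply: nP => _; rewrite -gl.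
  rewrite (bigD1 l) //= /F1 indicE mem_set // mule1 Fc big1 ?adde0 // => k kl.
  rewrite indicE memNset ?mule0 //= => /(letter_inj hs) lk.
  by rewrite lk eqxx in kl.
Qed.

End UniformIntegral.

(** * Entropy from densities *)

Lemma bounded_measurable_integrable (R : realType) (d : measure_display)
    (X : measurableType d) (eta : {finite_measure set X -> \bar R})
    (f : X -> R) (M : R) :
  measurable_fun setT f -> (forall x, `|f x| <= M) ->
  eta.-integrable setT (EFin \o f).
Proof.
move=> mf fM; apply: measurable_bounded_integrable => //.
  by rewrite -ge0_fin_numE // fin_num_measure.
by exists M; split; [exact: num_real|move=> N MN x _ /=; exact: le_trans (ltW MN)].
Qed.

Lemma normr_ln_le (R : realType) (c x : R) :
  0 < c -> c^-1 <= x <= c -> `|ln x| <= ln c.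
Proof.
move=> c0 /andP[cx xc]; have x0 : 0 < x by rewrite (lt_le_trans _ cx) ?invr_gt0.
by rewrite ler_norml -lnV // !ler_ln // ?posrE ?invr_gt0 // cx xc.
Qed.

Section EntropyOfDensity.
Context (R : realType) (G : groupType) (r : nat) (s : 'I_r -> G).
Local Notation L := ('I_r * bool)%type.
Hypotheses (r_gt0 : (0 < r)%N) (hs : freely_generates s).
Local Notation mu := (@uniform_on R G (generators_and_inverses s)).
Context (d : measure_display) (X : measurableType d).
Context (a : measurable_action G X) (eta : probability X R).

Lemma translate_dominated (g : G) (f : X -> R) :
  eta.-integrable setT (EFin \o f) ->
  (forall E, measurable E ->
    translate a eta g E = (\int[eta]_(x in E) (f x)%:E)%E) ->
  charge_of_finite_measure (translate a eta g) `<< eta.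
Proof.
move=> intf fE; apply/null_content_dominatesP => E mE eE0; rewrite [LHS]fE //.
have /integrableP[mf _] := intf.
apply: null_set_integral => //.
exact: (measurable_funS measurableT (@subsetT _ _) mf).
Qed.

Lemma Radon_Nikodym_translate (g : G) (f : X -> R) :
  eta.-integrable setT (EFin \o f) ->
  (forall E, measurable E ->
    translate a eta g E = (\int[eta]_(x in E) (f x)%:E)%E) ->
  ae_eq eta setT (Radon_Nikodym
    (charge_of_finite_measure (translate a eta g)) eta) (EFin \o f).
Proof.
move=> intf fE; have dom := translate_dominated intf fE.
apply: integral_ae_eq => //.
- exact: Radon_Nikodym_integrable.
- by have /integrableP[] := intf.
- by move=> E _ mE; rewrite -Radon_Nikodym_integral //; exact: fE.
Qed.

(** The Radon-Nikodym derivative agrees almost everywhere with [f l], and the bounds on [f l] keep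
    its logarithm integrable, so that the extended integrals are real ones. *)
Lemma entropy_of_density (f : L -> X -> R) (c : R) : 0 < c ->
  (forall l, measurable_fun setT (f l)) ->
  (forall l x, c^-1 <= f l x <= c) ->
  (forall l E, measurable E ->
    translate a eta (letter s l) E = (\int[eta]_(x in E) (f l x)%:E)%E) ->
  furstenberg_entropy mu a eta =
  ((r * 2)%:R^-1 * \sum_l \int[eta]_x - ln (f l x))%:E.
Proof.
move=> c0 mf fc fE.
have f0 l x : 0 < f l x.
  by have /andP[+ _] := fc l x; apply: lt_le_trans; rewrite invr_gt0.
rewrite /furstenberg_entropy (integral_uniform_on r_gt0 hs
  (c := fun l => \int[eta]_x - ln (f l x))) // => l.
set rho := Radon_Nikodym _ _.
have intf : eta.-integrable setT (EFin \o f l).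
  apply: (@bounded_measurable_integrable _ _ _ _ _ c) => // x.
  by rewrite gtr0_norm //; case/andP: (fc l x).
have rhof := Radon_Nikodym_translate intf (fE l).
rewrite -/rho in rhof.
have mrho : measurable_fun [set: X] (rho : X -> \bar R).
  apply: measurable_int; apply: Radon_Nikodym_integrable.
  exact: translate_dominated intf (fE l).
have mln : measurable_fun setT (fun x => - ln (f l x)).
  by apply: measurable_funN; exact: measurableT_comp.
transitivity (\int[eta]_x (- ln (f l x))%:E)%E.
  apply: ae_eq_integral => //.
  - apply: measurableT_comp => //.
    (* Splitting off the infinite values of [lne] reduces its measurability to that of [ln]. *)
    rewrite (_ : (fun x => lne (rho x)) = fun x =>
      if (rho x <= 0)%E then -oo%E else
      if (+oo <= rho x)%E then +oo%E else (ln (fine (rho x)))%:E); last first.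
      by apply/funext => x; case: (rho x) => [y| |] //=; rewrite leNye.
    apply: measurable_fun_ifT => //; first exact: measurable_fun_lee.
    apply: measurable_fun_ifT => //; first exact: measurable_fun_lee.
    apply/measurable_EFinP; apply: measurableT_comp => //.
    by apply: measurableT_comp.
  - exact/measurable_EFinP.
  - by apply: filterS rhof => x /(_ I) -> _; rewrite lne_EFin.
rewrite /Rintegral fineK //; apply: integrable_fin_num => //.
apply: (@bounded_measurable_integrable _ _ _ _ _ (ln c)) => // x.
by rewrite normrN normr_ln_le.
Qed.

End EntropyOfDensity.

(** * The upper bound *)

(** On the set where [g < f] the integral of [|f - g|] is at most 0 by hypothesis, so [f = g] almost
    everywhere there, which leaves only a null set. *)
Lemma integral_le_ae (R : realType) (d : measure_display)
    (X : measurableType d) (eta : {finite_measure set X -> \bar R})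
    (f g : X -> R) :
  eta.-integrable setT (EFin \o f) -> eta.-integrable setT (EFin \o g) ->
  (forall E, measurable E ->
    (\int[eta]_(x in E) (f x)%:E <= \int[eta]_(x in E) (g x)%:E)%E) ->
  {ae eta, forall x, f x <= g x}.
Proof.
move=> intf intg fg.
have mf : measurable_fun setT f by apply/measurable_EFinP; case/integrableP: intf.
have mg : measurable_fun setT g by apply/measurable_EFinP; case/integrableP: intg.
pose E := [set x | g x < f x].
have mE : measurable E.
  by rewrite -[E]setTI; apply: measurable_fun_ltr.
have /ae_eq_integral_abs : (\int[eta]_(x in E) `|(f x - g x)%:E| = 0)%E.
  rewrite (eq_integral (fun x => (f x)%:E - (g x)%:E)%E); last first.
    by move=> x /set_mem Ex; rewrite abse_EFin gtr0_norm ?subr_gt0 // EFinB.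
  apply/eqP; rewrite eq_le; apply/andP; split.
    rewrite integralB //; [|exact: integrableS intf|exact: integrableS intg].
    by rewrite sube_le0 fg.
  by apply: integral_ge0 => x Ex; rewrite -EFinB lee_fin subr_ge0 ltW.
move=> /(_ mE) ae0; apply: filterS (ae0 _).
  move=> x Efg; rewrite leNgt; apply/negP => Ex.
  have [/eqP] := Efg Ex; rewrite subr_eq0 => /eqP e.
  by move: Ex; rewrite e ltxx.
by apply/measurable_EFinP; apply: measurable_funTS; exact: measurable_funB.
Qed.

(** * Distortion bounds for stationary measures *)

Section Stationary.
Context (R : realType) (G : groupType) (r : nat) (s : 'I_r -> G).
Local Notation L := ('I_r * bool)%type.
Hypotheses (r_gt1 : (1 < r)%N) (hs : freely_generates s).
Local Notation mu := (@uniform_on R G (generators_and_inverses s)).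
Context (d : measure_display) (X : measurableType d).
Context (a : measurable_action G X) (eta : probability X R).

Let r_gt0 : (0 < r)%N. Proof. exact: ltnW. Qed.

Local Notation N := ((r * 2)%:R : R).
Local Notation q := ((r * 2).-1%:R : R).
Local Notation nu l := (translate a eta (letter s l)).

Let NE : N = q + 1.
Proof. by rewrite natr1 prednK // muln_gt0 r_gt0. Qed.

Lemma measurable_act_image g (E : set X) : measurable E -> measurable (a g @` E).
Proof.
by move=> mE; rewrite act_image -[X in measurable X]setTI; exact: measurable_act.
Qed.

Lemma act_imageK g (E : set X) : a (g^-1)%g @` (a g @` E) = E.
Proof.
apply/seteqP; split=> [_ [_ [y Ey <-] <-]|x Ex].
  by rewrite -actM mulVg act1.
by exists (a g x); [exists x|rewrite -actM mulVg act1].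
Qed.

(** Pushing [eta] forward by a letter is translating it by the inverse letter. Inversion permutes
    the letters, so reindexing the sum gives the translates themselves. *)
Lemma stationaryP : stationary mu a eta <->
  forall E, measurable E -> eta E = (N^-1 * \sum_l fine (nu l E))%:E.
Proof.
have conv E : measurable E ->
    convolution mu a eta E = (N^-1 * \sum_l fine (nu l E))%:E.
  move=> mE; rewrite /convolution (integral_uniform_on r_gt0 hs
    (c := fun l => fine (nu (inv_letter l) E))).
    by rewrite [in RHS](reindex_inj (inv_inj (@inv_letterK r))) /=.
  move=> l; rewrite fineK; last exact: fin_num_measure.
  by rewrite letter_inv /translate act_image invgK.
by split => st E mE; rewrite st // conv.
Qed.


Lemma translate_inv_image g (E : set X) :
  translate a eta (g^-1)%g (a g @` E) = eta E.
Proof. by rewrite /translate act_imageK. Qed.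

Lemma fine_translate_inv_image l (E : set X) :
  fine (nu (inv_letter l) (a (letter s l) @` E)) = fine (eta E).
Proof. by rewrite letter_inv translate_inv_image. Qed.

Hypothesis st : stationary mu a eta.

Lemma stationary_sum (E : set X) : measurable E ->
  \sum_l fine (nu l E) = N * fine (eta E).
Proof.
move=> mE; move/stationaryP : st => /(_ E mE) -> /=.
rewrite mulrA divff ?mul1r //.
by rewrite pnatr_eq0 -lt0n muln_gt0 r_gt0.
Qed.

(* If every letter shrinks sets by a factor at least [delta], summing over the
   letters bounds the expansion by [N - q * delta], so the inverse letters
   shrink by at least [(N - q * delta)^-1]. *)
Let contraction delta := 0 <= delta <= 1 /\ forall l E, measurable E ->
  delta * fine (eta E) <= fine (nu l E).

Let q_ge1 : 1 <= q.
Proof. by rewrite ler1n; move: r_gt1; lia. Qed.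

Let contraction_step delta : contraction delta -> contraction (N - q * delta)^-1.
Proof.
move=> [/andP[d0 d1] hd].
have Nd : 1 <= N - q * delta.
  have : q * delta <= q by rewrite ler_piMr // (le_trans _ q_ge1).
  by rewrite NE; lra.
split.
  by rewrite invr_ge0 (le_trans _ Nd) //= invf_le1 // (lt_le_trans _ Nd).
move=> l E mE; rewrite -(fine_translate_inv_image l) ler_pdivrMl; last first.
  exact: lt_le_trans Nd.
set F := a (letter s l) @` E.
have mF : measurable F by exact: measurable_act_image.
have <- : fine (eta F) = fine (nu l E) by [].
(* By stationarity the translated measures of [F] sum to [N] times that of [F]; the [q] letters
   other than [inv_letter l] account for at least [q * delta] times it. *)
rewrite mulrBl -(stationary_sum mF) (bigD1 (inv_letter l)) //=.
rewrite -addrA lerDl subr_ge0.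
apply: (@le_trans _ _ (\sum_(i | i != inv_letter l) delta * fine (eta F))).
  rewrite sumr_const cardC1 card_prod card_ord card_bool.
  by rewrite -[leRHS]mulr_natl mulrA.
by apply: ler_sum => i _; exact: hd.
Qed.

(** The supremum [t] of the contraction factors is itself one, so [contraction_step] gives
    [(N - q * t)^-1 <= t], that is [0 <= (1 - t) * (q * t - 1)]. Hence [t = 1] or [q^-1 <= t], and
    [q^-1 <= 1] anyway. *)
Lemma stationary_lower_bound l (E : set X) : measurable E ->
  q^-1 * fine (eta E) <= fine (nu l E).
Proof.
move=> mE.
have c0 : contraction 0.
  by split=> [|k F mF]; rewrite ?lexx ?ler01 // mul0r fine_ge0.
have hsup : has_sup [set delta | contraction delta].
  by split; [exists 0|exists 1 => delta [/andP[]]].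
set t := sup [set delta | contraction delta].
have t0 : 0 <= t by exact: sup_upper_bound.
have t1 : t <= 1 by apply: ge_sup; [exists 0|move=> delta [/andP[]]].
have ct : contraction t.
  split=> [|k F mF]; first by rewrite t0 t1.
  have : 0 <= fine (eta F) by exact: fine_ge0.
  rewrite le_eqVlt => /orP[/eqP <-|F0].
    by rewrite mulr0 fine_ge0.
  rewrite -ler_pdivlMr //; apply: ge_sup; first by exists 0.
  by move=> delta [_ hd]; rewrite ler_pdivlMr // hd.
have /(sup_upper_bound hsup) := contraction_step ct; rewrite -/t => h.
have q0 : 0 < q by exact: lt_le_trans q_ge1.
have Nt : 0 < N - q * t.
  have : q * t <= q by rewrite ler_piMr // ltW.
  by rewrite NE; lra.
have {}h : 0 <= (1 - t) * (q * t - 1).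
  by move: h; rewrite -[_^-1]mul1r ler_pdivrMr // NE; nra.
have qt : q^-1 <= t.
  rewrite -[_^-1]mul1r ler_pdivrMr // mulrC.
  have [t1'|t1'] := ltP t 1; last by rewrite (le_trans q_ge1) // ler_peMr // ltW.
  by move: h; rewrite pmulr_rge0 ?subr_gt0 // subr_ge0.
have [_ /(_ l E mE)] := ct; apply: le_trans.
by rewrite ler_wpM2r // fine_ge0.
Qed.

Lemma stationary_upper_bound l (E : set X) : measurable E ->
  fine (nu l E) <= q * fine (eta E).
Proof.
move=> mE; have := stationary_lower_bound (inv_letter l)
  (measurable_act_image (letter s l) mE).
rewrite fine_translate_inv_image ler_pdivrMl //.
exact: lt_le_trans q_ge1.
Qed.

End Stationary.

(** * Change of variables along a group element *)

Section ChangeOfVariables.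
Context (R : realType) (G : groupType).
Context (d : measure_display) (X : measurableType d).
Context (a : measurable_action G X) (eta : probability X R).

Lemma integral_translate (g : G) (f h : X -> R) (M M' : R) (E : set X) :
  measurable_fun setT f -> (forall x, `|f x| <= M) ->
  measurable_fun setT h -> (forall x, `|h x| <= M') ->
  (forall F, measurable F ->
    translate a eta g F = (\int[eta]_(x in F) (f x)%:E)%E) ->
  measurable E ->
  (\int[translate a eta g]_(x in E) (h x)%:E =
   \int[eta]_(x in E) (h x * f x)%:E)%E.
Proof.
move=> mf fM mh hM fE mE.
have intf : eta.-integrable setT (EFin \o f).
  exact: bounded_measurable_integrable fM.
have dom := translate_dominated intf fE.
rewrite -(Radon_Nikodym_change_of_variables dom) //; last first.
  apply: (integrableS measurableT) => //.
  exact: bounded_measurable_integrable hM.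
apply: ae_eq_integral => //.
- apply: measurable_funTS; apply: emeasurable_funM.
    exact/measurable_EFinP.
  by apply: measurable_int; apply: Radon_Nikodym_integrable.
- by apply/measurable_EFinP; apply: measurable_funTS; exact: measurable_funM.
- apply: filterS (Radon_Nikodym_translate intf fE) => x /(_ I) -> _ /=.
  by rewrite EFinM.
Qed.

(* [eta] is the image of [translate a eta g] under [g]. *)
Lemma integral_act (g : G) (h : X -> R) (M : R) (E : set X) :
  measurable_fun setT h -> (forall x, `|h x| <= M) -> measurable E ->
  (\int[eta]_(x in E) (h (a (g^-1)%g x))%:E =
   \int[translate a eta g]_(x in a g @^-1` E) (h x)%:E)%E.
Proof.
move=> mh hM mE; have mg := measurable_act a g.
have mg' := measurable_act a (g^-1)%g.
rewrite (eq_measure_integral (pushforward (translate a eta g) (a g))).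
  rewrite integral_pushforward //.
  - by apply: eq_integral => x _ /=; rewrite -actM mulVg act1.
  - by apply/measurable_EFinP; exact: measurableT_comp.
  - apply: (integrableS measurableT) => //.
      by rewrite -[X in measurable X]setTI; exact: mg.
    apply: (@bounded_measurable_integrable _ _ _ (translate a eta g)
      (h \o a (g^-1)%g \o a g) M) => [|x]; last exact: hM.
    by apply: measurableT_comp => //; exact: measurableT_comp.
move=> F mF _; rewrite /pushforward /translate; congr (eta _).
apply/seteqP; split=> [x Fx|_ [x Fx <-] //].
by exists (a (g^-1)%g x); rewrite /= -actM mulgV act1.
Qed.

End ChangeOfVariables.

(** For [1 <= c] both [(c - 1) / (c + 1)] and [ln c] increase, so their product is largest at
    [c = q]. The case [c < 1] follows by passing to [c^-1] and multiplying by [c]. *)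
Lemma chord_ln (R : realType) (q c : R) : q^-1 <= c <= q -> 0 < q ->
  (c - 1) * ln c <= (q - 1) / (q + 1) * ln q * (c + 1).
Proof.
have ge1 (x : R) : 1 <= x -> x <= q ->
    (x - 1) * ln x <= (q - 1) / (q + 1) * ln q * (x + 1).
  move=> x1 xq; rewrite mulrAC -mulrAC -mulrA [ln q * _]mulrC mulrA.
  apply: ler_pM; rewrite ?subr_ge0 ?ln_ge0 //.
    by rewrite mulrAC ler_pdivlMr; [nra|lra].
  by rewrite ler_ln ?posrE //; lra.
move=> /andP[qc cq] q0.
have c0 : 0 < c by rewrite (lt_le_trans _ qc) // invr_gt0.
have [c1|c1] := leP 1 c; first exact: ge1.
have cV1 : 1 <= c^-1 by rewrite invf_ge1 // ltW.
have cVq : c^-1 <= q by rewrite invf_ple.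
have := ge1 _ cV1 cVq; rewrite lnV ?posrE // -(ler_pM2r c0).
set C := _ * ln q; have cn0 : c != 0 by rewrite gt_eqF.
rewrite (_ : _ * c = (c - 1) * ln c); last by field.
by rewrite (_ : _ * c = C * (c + 1)); last by field.
Qed.

Section EntropyBound.
Context (R : realType) (G : groupType) (r : nat) (s : 'I_r -> G).
Local Notation L := ('I_r * bool)%type.
Hypotheses (r_gt1 : (1 < r)%N) (hs : freely_generates s).
Local Notation mu := (@uniform_on R G (generators_and_inverses s)).
Context (d : measure_display) (X : measurableType d).
Context (a : measurable_action G X) (eta : probability X R).
Hypothesis st : stationary mu a eta.

Local Notation N := ((r * 2)%:R : R).
Local Notation q := ((r * 2).-1%:R : R).
Local Notation nu l := (translate a eta (letter s l)).

Let r_gt0 : (0 < r)%N. Proof. exact: ltnW. Qed.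

Let q_ge1 : 1 <= q.
Proof. by rewrite ler1n; move: r_gt1; lia. Qed.

Let q_gt0 : 0 < q.
Proof. exact: lt_le_trans q_ge1. Qed.

Let q_inv_le : q^-1 <= q.
Proof. by rewrite (le_trans _ q_ge1) // invf_le1. Qed.

Lemma stationary_density : exists f : L -> X -> R,
  [/\ forall l, measurable_fun setT (f l),
      forall l x, q^-1 <= f l x <= q &
      forall l E, measurable E -> nu l E = (\int[eta]_(x in E) (f l x)%:E)%E].
Proof.
pose g l x := fine (Radon_Nikodym (charge_of_finite_measure (nu l)) eta x).
(* The bounds on measures control the derivative only almost everywhere; clamping it gives a version
   that is bounded everywhere. *)
pose f l x := Num.max q^-1 (Num.min q (g l x)).
have dom l : charge_of_finite_measure (nu l) `<< eta.
  apply/null_content_dominatesP => E mE eE0.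
  rewrite -[LHS]/(nu l E); apply/eqP.
  rewrite -(@fineK _ (nu l E)) ?fin_num_measure // eqe.
  rewrite eq_le fine_ge0 // andbT.
  by rewrite (le_trans (stationary_upper_bound r_gt1 hs st l mE)) // eE0 mulr0.
have gE l : EFin \o g l =
    Radon_Nikodym (charge_of_finite_measure (nu l)) eta.
  by apply/funext => x /=; rewrite fineK // Radon_Nikodym_fin_num //; exact: dom.
have intg l : eta.-integrable setT (EFin \o g l).
  by rewrite gE; exact: (Radon_Nikodym_integrable (dom l)).
have mg l : measurable_fun setT (g l).
  by apply/measurable_EFinP; case/integrableP: (intg l).
have nuE l E : measurable E -> nu l E = (\int[eta]_(x in E) (g l x)%:E)%E.
  move=> mE; rewrite -[LHS]/(charge_of_finite_measure (nu l) E).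
  rewrite (Radon_Nikodym_integral (dom l) mE).
  by apply: eq_integral => x _; rewrite -gE.
have intc (c : R) : eta.-integrable setT (EFin \o cst c).
  by apply: (@bounded_measurable_integrable _ _ _ _ _ `|c|).
have icst (c : R) E : measurable E ->
    (\int[eta]_(x in E) (cst c x)%:E = (c * fine (eta E))%:E)%E.
  move=> mE; rewrite EFinM fineK ?fin_num_measure //.
  exact: (integral_cst eta mE c%:E).
have glb l : {ae eta, forall x, q^-1 <= g l x}.
  apply: (integral_le_ae (intc q^-1) (intg l)) => E mE.
  rewrite -nuE // icst // -(@fineK _ (nu l E)) ?fin_num_measure // lee_fin.
  exact: stationary_lower_bound.
have gub l : {ae eta, forall x, g l x <= q}.
  apply: (integral_le_ae (intg l) (intc q)) => E mE.
  rewrite -nuE // icst // -(@fineK _ (nu l E)) ?fin_num_measure // lee_fin.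
  exact: stationary_upper_bound.
have mf l : measurable_fun setT (f l).
  by apply: measurable_maxr => //; exact: measurable_minr.
exists f; split => // [l x|l E mE].
  by rewrite /f le_max lexx /= ge_max q_inv_le ge_min lexx.
rewrite nuE //; apply: ae_eq_integral => //.
- by apply/measurable_EFinP; exact: measurable_funTS.
- by apply/measurable_EFinP; exact: measurable_funTS.
- apply: filterS2 (glb l) (gub l) => x gx1 gx2 _.
  by rewrite /f (min_idPr gx2) (max_idPr gx1).
Qed.

Context (f : L -> X -> R).
Hypotheses (mf : forall l, measurable_fun setT (f l))
  (fq : forall l x, q^-1 <= f l x <= q)
  (fE : forall l E, measurable E ->
     nu l E = (\int[eta]_(x in E) (f l x)%:E)%E).

Let f_gt0 l x : 0 < f l x.
Proof. by have /andP[+ _] := fq l x; apply: lt_le_trans; rewrite invr_gt0. Qed.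

Let f_le l x : `|f l x| <= q.
Proof. by rewrite gtr0_norm //; case/andP: (fq l x). Qed.

Let mfV l : measurable_fun setT (fun x => (f l x)^-1).
Proof.
have -> : (fun x => (f l x)^-1) = (fun x => expR (- ln (f l x))).
  by apply/funext => x; rewrite expRN lnK // posrE.
by apply: measurableT_comp => //; apply: measurable_funN; exact: measurableT_comp.
Qed.

Let mln l : measurable_fun setT (fun x => ln (f l x)).
Proof. exact: measurableT_comp. Qed.

Let fV_le l x : `|(f l x)^-1| <= q.
Proof.
rewrite gtr0_norm ?invr_gt0 // invf_ple ?posrE //.
by case/andP: (fq l x).
Qed.

Let ln_le l x : `|ln (f l x)| <= ln q.
Proof. exact: normr_ln_le. Qed.

(** This is the chain rule for a letter and its inverse. Moving the integral of the right-hand side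
    over [E] along the letter turns the integrand into [(f l)^-1 * f l = 1], which leaves the
    measure of the translated set. *)
Lemma inv_letter_density l : ae_eq eta setT (EFin \o f (inv_letter l))
  (fun x => ((f l (a (letter s (inv_letter l)) x))^-1)%:E).
Proof.
apply: integral_ae_eq => //.
- exact: bounded_measurable_integrable (f_le _).
- apply/measurable_EFinP.
  exact: (measurableT_comp (mfV l) (measurable_act a _)).
- move=> E _ mE; rewrite -fE // letter_inv.
  rewrite (integral_act a eta _ (mfV l) (fV_le l)) //.
  have mE' : measurable (a (letter s l) @^-1` E).
    by rewrite -[X in measurable X]setTI; exact: measurable_act.
  rewrite (integral_translate (mf l) (f_le l) (mfV l) (fV_le l) (@fE l)) //.
  under eq_integral do rewrite mulVf ?gt_eqF //.
  rewrite (integral_cst eta mE' 1%E) mul1e /translate act_image invgK //.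
Qed.

(** By [inv_letter_density] the left-hand integrand is [ln (f l)] evaluated along the inverse
    letter; changing variables brings in the density [f l]. *)
Lemma integral_ln_inv_letter l :
  \int[eta]_x - ln (f (inv_letter l) x) = \int[eta]_x (ln (f l x) * f l x).
Proof.
rewrite /Rintegral; congr fine.
rewrite -(integral_translate (mf l) (f_le l) (mln l) (ln_le l) (@fE l)) //.
have := integral_act a eta (letter s l) (mln l) (ln_le l) measurableT.
rewrite preimage_setT => <-.
apply: ae_eq_integral => //.
- by apply/measurable_EFinP; apply: measurable_funN; exact: mln.
- apply/measurable_EFinP.
  exact: (measurableT_comp (mln l) (measurable_act a _)).
- apply: filterS (inv_letter_density l) => x /(_ I) /= [] -> _.
  by rewrite letter_inv lnV ?opprK // posrE.
Qed.

Lemma sum_entropy_le : \sum_l \int[eta]_x - ln (f l x) <=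
  N * ((q - 1) / (q + 1) * ln q).
Proof.
set C := (q - 1) / (q + 1) * ln q.
have intl l : eta.-integrable setT (EFin \o (fun x => ln (f l x))).
  exact: bounded_measurable_integrable (ln_le l).
have intNl l : eta.-integrable setT (EFin \o (fun x => - ln (f l x))).
  apply: (@bounded_measurable_integrable _ _ _ _ _ (ln q)) => [|x].
    exact: measurable_funN.
  by rewrite normrN.
have intlf l : eta.-integrable setT (EFin \o (fun x => ln (f l x) * f l x)).
  apply: (@bounded_measurable_integrable _ _ _ _ _ (ln q * q)) => [|x].
    exact: measurable_funM.
  by rewrite normrM ler_pM.
have intf l : eta.-integrable setT (EFin \o f l).
  exact: bounded_measurable_integrable (f_le l).
have int1 : eta.-integrable setT (EFin \o cst (1 : R)).
  by apply: (@bounded_measurable_integrable _ _ _ _ _ `|1|).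
have f1 l : \int[eta]_x f l x = 1.
  rewrite /Rintegral -fE // /translate (_ : _ @` _ = setT) ?probability_setT //.
  apply/seteqP; split => // x _; exists (a (letter s l)^-1%g x) => //.
  by rewrite -actM mulgV act1.
have intD (g h : X -> R) : eta.-integrable setT (EFin \o g) ->
    eta.-integrable setT (EFin \o h) ->
    eta.-integrable setT (EFin \o (fun x => g x + h x)).
  by move=> ig ih; exact: (integrableD measurableT ig ih).
(* For a letter and its inverse together the integrand is [(f l - 1) * ln (f l)], which [chord_ln]
   bounds; since [f l] has integral 1, the bound integrates to [C * 2]. *)
have half l : \int[eta]_x - ln (f l x) + \int[eta]_x - ln (f (inv_letter l) x)
    <= C * 2.
  rewrite integral_ln_inv_letter -RintegralD //.
  have <- : \int[eta]_x (C * (f l x + 1)) = C * 2.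
    rewrite RintegralZl //; last exact: intD.
    rewrite RintegralD // f1 Rintegral_cst // mul1r.
    rewrite -[2]/(1 + 1); congr (_ * (1 + _)).
    exact: (congr1 fine (@probability_setT _ _ _ eta)).
  apply: le_Rintegral => // [||x _].
  - exact: intD.
  - exact: (integrableZl measurableT C (intD _ _ (intf l) int1)).
  - rewrite (_ : _ + _ = (f l x - 1) * ln (f l x)); last by ring.
    exact: chord_ln.
have -> : \sum_l \int[eta]_x - ln (f l x) =
    2^-1 * \sum_l (\int[eta]_x - ln (f l x) +
                   \int[eta]_x - ln (f (inv_letter l) x)).
  rewrite big_split /=.
  have /= <- := reindex_inj (op := +%R) (inv_inj (@inv_letterK r))
    (P := xpredT) (F := fun l => \int[eta]_x - ln (f l x)).
  by field.
have -> : N * C = 2^-1 * \sum_(l : L) (C * 2).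
  rewrite sumr_const card_prod card_ord card_bool -mulr_natl; by field.
by rewrite ler_pM2l //; apply: ler_sum => l _.
Qed.

End EntropyBound.

Lemma stationary_entropy_le (R : realType) (G : groupType) (r : nat)
    (s : 'I_r -> G) (d : measure_display) (X : measurableType d)
    (a : measurable_action G X) (eta : probability X R) :
  (1 < r)%N -> freely_generates s ->
  let mu := @uniform_on R G (generators_and_inverses s) in
  let q := (r * 2).-1%:R in
  stationary mu a eta ->
  (furstenberg_entropy mu a eta <= ((q - 1) / (q + 1) * ln q)%:E)%E.
Proof.
move=> r1 hs mu q st; have r0 : (0 < r)%N by exact: ltnW.
have [f [mf fq fE]] := stationary_density r1 hs st.
have q0 : 0 < q by rewrite ltr0n; move: r1; lia.
rewrite (entropy_of_density r0 hs q0 mf fq fE) lee_fin.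
rewrite ler_pdivrMl ?ltr0n ?muln_gt0 ?r0 //.
by apply: (sum_entropy_le r1 mf fq fE).
Qed.

(** * The unit interval and its digits *)

(** The interval is half-open so that cutting off the first digit is a bijection at every point; the
    letters are then true bijections, with no null set to discard. *)
Definition unit_interval (R : realType) : Type := {x : R | 0 <= x < 1}.

Section UnitInterval.
Context (R : realType).
Local Notation Y := (unit_interval R).
Local Notation leb := (@lebesgue_measure R).

Definition uval (y : Y) : R := sval y.

Definition to_unit (x : R) (x01 : 0 <= x < 1) : Y :=
  exist (fun x : R => is_true (0 <= x < 1)) x x01.

Lemma uval_itv y : 0 <= uval y < 1. Proof. exact: (svalP y). Qed.

Lemma uval_inj : injective uval. Proof. exact: val_inj. Qed.

Lemma unit_interval_point_proof : 0 <= (0 : R) < 1.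
Proof. by rewrite lexx ltr01. Qed.

HB.instance Definition _ := Choice.on Y.
HB.instance Definition _ := isPointed.Build Y
  (to_unit unit_interval_point_proof).

Definition unit_measurable : set (set Y) :=
  [set E | measurable (uval @` E : set (measurableTypeR R))].

Lemma unit_measurable0 : unit_measurable set0.
Proof. by rewrite /unit_measurable /= image_set0. Qed.

Lemma range_uval : range uval = `[0, 1[%classic.
Proof.
apply/seteqP; split=> [_ [y _ <-]|x] /=; first by rewrite in_itv /= uval_itv.
by rewrite in_itv /= => x01; exists (exist _ x x01).
Qed.

Lemma image_uvalC (E : set Y) : uval @` (~` E) = `[0, 1[ `\` (uval @` E).
Proof.
rewrite -range_uval; apply/seteqP; split=> [_ [y Ey <-]|_ [[y _ <-] nE]].
  by split; [exists y|move=> [z Ez /uval_inj zy]; apply: Ey; rewrite -zy].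
by exists y => // Ey; apply: nE; exists y.
Qed.

Lemma unit_measurableC E : unit_measurable E -> unit_measurable (~` E).
Proof.
by move=> mE; rewrite /unit_measurable /= image_uvalC; apply: measurableD.
Qed.

Lemma unit_measurable_bigcup (F : (set Y)^nat) :
  (forall i, unit_measurable (F i)) -> unit_measurable (\bigcup_i F i).
Proof.
move=> mF; rewrite /unit_measurable /= image_bigcup.
by apply: bigcup_measurable => i _; exact: mF.
Qed.

HB.instance Definition _ := @isMeasurable.Build default_measure_display
  Y unit_measurable unit_measurable0 unit_measurableC unit_measurable_bigcup.

Lemma measurable_uval (B : set (measurableTypeR R)) :
  measurable B -> measurable (uval @^-1` B).
Proof.
move=> mB; rewrite /measurable /= /unit_measurable /=.
have -> : uval @` (uval @^-1` B) = B `&` `[0, 1[%classic.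
  rewrite -range_uval; apply/seteqP; split=> [_ [y By <-]|x [Bx [y _ xE]]].
    by split=> //; exists y.
  by exists y => //=; rewrite xE.
exact: measurableI.
Qed.

Definition unit_leb (E : set Y) : \bar R := leb (uval @` E).

Let unit_leb0 : unit_leb set0 = 0%E.
Proof. by rewrite /unit_leb image_set0 measure0. Qed.

Let unit_leb_ge0 E : (0 <= unit_leb E)%E.
Proof. exact: measure_ge0. Qed.

Let unit_leb_sigma_additive : semi_sigma_additive unit_leb.
Proof.
move=> F mF tF _; rewrite /unit_leb image_bigcup.
apply: measure_semi_sigma_additive => //; last first.
  by apply: bigcup_measurable => i _; exact: mF.
apply/trivIsetP => i j _ _ ij; apply/seteqP; split=> // x.
move=> [[y Fy yx] [z Fz zx]].
have yz : z = y by apply: uval_inj; rewrite yx zx.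
have : (F i `&` F j) y by split; rewrite // -yz.
by move/trivIsetP: tF => /(_ i j I I ij) ->.
Qed.

HB.instance Definition _ := isMeasure.Build _ _ _ unit_leb
  unit_leb0 unit_leb_ge0 unit_leb_sigma_additive.

Let unit_lebT : unit_leb setT = 1%E.
Proof.
by rewrite /unit_leb range_uval lebesgue_measure_itv /= lte01 sube0.
Qed.

HB.instance Definition _ := Measure_isProbability.Build _ _ _ unit_leb unit_lebT.

End UnitInterval.

Arguments uval {R} y : simpl never.

Lemma measure_fibers (d : measure_display) (X : measurableType d)
    (R : realType) (m : {measure set X -> \bar R}) (I : finType) (p : X -> I)
    (E : set X) : (forall i, measurable (E `&` [set x | p x = i])) ->
  m E = (\sum_i m (E `&` [set x | p x = i]))%E.
Proof.
move=> mE; have -> : (\sum_i m (E `&` [set x | p x = i]) =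
    \sum_(j < #|I|) m (E `&` [set x | p x = enum_val j]))%E.
  rewrite -(big_enum_val (fun i => m (E `&` [set x | p x = i]))) /=.
  exact: eq_bigl.
rewrite -measure_bigsetU_ord //.
  congr (m _); apply/seteqP; split=> [x Ex|x].
    rewrite -bigcup_seq; exists (enum_rank (p x)); first exact: mem_index_enum.
    by split => //=; rewrite enum_rankK.
  by rewrite -bigcup_seq => -[j _ []].
apply/trivIsetP => i j _ _ ij; apply/seteqP; split=> // x [[_ /= xi] [_ /= xj]].
by move: ij; rewrite -(inj_eq enum_val_inj) -xi -xj eqxx.
Qed.

(** This follows from uniqueness of Lebesgue measure: [c] times the pushforward gives every
    half-open interval its length. *)
Lemma lebesgue_measure_affine (R : realType) (c b : R)
    (A : set (measurableTypeR R)) : 0 < c -> measurable A ->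
  lebesgue_measure ((fun x => c * x - b) @^-1` A) =
  (c^-1%:E * lebesgue_measure A)%E.
Proof.
move=> c0 mA; pose phi (x : measurableTypeR R) : measurableTypeR R := c * x - b.
have mphi : measurable_fun setT phi.
  by apply: measurable_funB => //; exact: measurable_funM.
have <- : (c%:E * pushforward lebesgue_measure phi A)%E = lebesgue_measure A.
  apply/esym; apply: (lebesgue_measure_unique
    (mu := mscale (NngNum (ltW c0)) (pushforward lebesgue_measure phi))) => //.
  move=> _ [[u v] _ <-] /=.
  rewrite -[RHS]/(c%:E * lebesgue_measure (phi @^-1` `]u, v]))%E.
  have -> : phi @^-1` `]u, v] = `](u + b) / c, (v + b) / c]%classic.
    apply/seteqP; split=> x /=; rewrite !in_itv /= /phi;
      by rewrite ltr_pdivrMr // ler_pdivlMr // mulrC; lra.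
  rewrite lebesgue_measure_itv /= !lebesgue_measure_itv /=.
  rewrite !lte_fin ltr_pM2r ?invr_gt0 // ltrD2r; case: ifP => _.
    rewrite -!EFinB -EFinM; congr EFin; field.
    by rewrite gt_eqF.
  by rewrite mule0.
rewrite /pushforward muleA -EFinM mulVf ?mul1e // gt_eqF //.
Qed.

(** * Base-[k] digits of the points of the unit interval *)

Section Digits.
Context (R : realType) (k : nat).
Hypothesis k_gt1 : (1 < k)%N.
Local Notation Y := (unit_interval R).
Local Notation leb := (@lebesgue_measure R).

Let k_gt0 : 0 < k%:R :> R.
Proof. by rewrite ltr0n ltnW. Qed.

Lemma digit_cons_proof (j : 'I_k) (y : Y) : 0 <= (uval y + j%:R) / k%:R < 1.
Proof.
have /andP[y0 y1] := uval_itv y.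
rewrite divr_ge0 ?addr_ge0 //= ltr_pdivrMr // mul1r.
have : j.+1%:R <= k%:R :> R by rewrite ler_nat.
by rewrite -natr1; lra.
Qed.

Definition digit_cons (j : 'I_k) (y : Y) : Y := to_unit (digit_cons_proof j y).

Lemma uval_digit_cons j y : uval (digit_cons j y) = (uval y + j%:R) / k%:R.
Proof. by []. Qed.

Let trunc_bounds (y : Y) :
  (Num.truncn (k%:R * uval y))%:R <= k%:R * uval y <
  (Num.truncn (k%:R * uval y)).+1%:R.
Proof.
have /andP[y0 y1] := uval_itv y.
by apply: truncn_itv; rewrite mulr_ge0 // ltW.
Qed.

Lemma digit_head_proof (y : Y) : (Num.truncn (k%:R * uval y) < k)%N.
Proof.
have /andP[y0 y1] := uval_itv y; have /andP[+ _] := trunc_bounds y.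
rewrite -(ltr_nat R) => /le_lt_trans; apply.
by rewrite gtr_pMr.
Qed.

Definition digit_head (y : Y) : 'I_k := Ordinal (digit_head_proof y).

Lemma digit_tail_proof (y : Y) :
  0 <= k%:R * uval y - (digit_head y)%:R < 1.
Proof. by have := trunc_bounds y; rewrite /= -natr1; lra. Qed.

Definition digit_tail (y : Y) : Y := to_unit (digit_tail_proof y).

Lemma digit_consK y : digit_cons (digit_head y) (digit_tail y) = y.
Proof.
apply: uval_inj; rewrite uval_digit_cons /uval /= subrK mulrC mulrA.
by rewrite mulVf ?mul1r // gt_eqF.
Qed.

Lemma digit_head_cons j y : digit_head (digit_cons j y) = j.
Proof.
apply: val_inj => /=; have /andP[y0 y1] := uval_itv y.
apply: truncn_def; rewrite mulrC divfK ?gt_eqF //.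
by rewrite -natr1; apply/andP; split; lra.
Qed.

Lemma digit_tail_cons j y : digit_tail (digit_cons j y) = y.
Proof.
apply: uval_inj; have hj := congr1 val (digit_head_cons j y).
rewrite -[LHS]/(k%:R * uval (digit_cons j y) - (val (digit_head (digit_cons j y)))%:R).
by rewrite hj uval_digit_cons mulrC divfK ?gt_eqF // addrK.
Qed.

(** The images of the maps [digit_cons j] are consecutive intervals, so the order is lexicographic
    in head and tail. This cuts an initial interval along first digits. *)
Lemma digit_cons_lt j (x y : Y) : (uval (digit_cons j y) < uval x) =
  ((j < digit_head x)%N || (j == digit_head x) && (uval y < uval (digit_tail x))).
Proof.
rewrite -{1}(digit_consK x) !uval_digit_cons ltr_pM2r ?invr_gt0 //.
have /andP[y0 y1] := uval_itv y; have /andP[z0 z1] := uval_itv (digit_tail x).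
move: (digit_head x) (digit_tail x) z0 z1 => i z z0 z1.
case: (ltngtP j i) => [ji|ij|/val_inj ->]; last by rewrite eqxx ltrD2r.
  have : j.+1%:R <= i%:R :> R by rewrite ler_nat.
  by rewrite -natr1 /= => h; apply/idP; lra.
rewrite -val_eqE /= gtn_eqF //=; apply/negbTE; rewrite -leNgt.
have : i.+1%:R <= j%:R :> R by rewrite ler_nat.
by rewrite -natr1; lra.
Qed.

Lemma measurable_cons_preimage (j : 'I_k) (E : set Y) :
  measurable E -> measurable (digit_cons j @^-1` E).
Proof.
move=> mE.
have -> : digit_cons j @^-1` E =
    @uval R @^-1` ((fun x => (x + j%:R) / k%:R) @^-1` (@uval R @` E)).
  apply/seteqP; split=> y /=; first by exists (digit_cons j y).
  move=> [z Ez zy]; have <- // : z = digit_cons j y.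
  by apply: uval_inj; rewrite zy.
apply: measurable_uval; rewrite -[X in measurable X]setTI.
by apply: measurable_funM => //; exact: measurable_funD.
Qed.

Lemma image_cons (j : 'I_k) (F : set Y) : @uval R @` (digit_cons j @` F) =
  (fun x => k%:R * x - j%:R) @^-1` (@uval R @` F).
Proof.
apply/seteqP; split=> [_ [_ [y Fy <-] <-]|x [y Fy yx]] /=.
  by exists y => //; rewrite uval_digit_cons mulrC divfK ?addrK // gt_eqF.
exists (digit_cons j y); first by exists y.
by rewrite uval_digit_cons yx subrK mulrC mulrA mulVf ?mul1r // gt_eqF.
Qed.

Lemma measurable_cons_image (j : 'I_k) (F : set Y) :
  measurable F -> measurable (digit_cons j @` F).
Proof.
move=> mF; rewrite /measurable /= /unit_measurable /= image_cons.
rewrite -[X in measurable X]setTI.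
by apply: measurable_funB => //; exact: measurable_funM.
Qed.

Lemma unit_leb_cons (j : 'I_k) (F : set Y) : measurable F ->
  unit_leb (digit_cons j @` F) = (k%:R^-1%:E * unit_leb F)%E.
Proof. by move=> mF; rewrite /unit_leb image_cons lebesgue_measure_affine. Qed.

Lemma cons_image_head (E : set Y) (j : 'I_k) :
  E `&` [set y | digit_head y = j] = digit_cons j @` (digit_cons j @^-1` E).
Proof.
apply/seteqP; split=> [y [Ey /= <-]|_ [y Ey <-]].
  by exists (digit_tail y); rewrite /= digit_consK.
by split => //=; rewrite digit_head_cons.
Qed.

Lemma measurable_digits (E : set Y) :
  (forall j, measurable (digit_cons j @^-1` E)) -> measurable E.
Proof.
move=> mE; have -> : E = \bigcup_(j in [set: 'I_k])
    (E `&` [set y | digit_head y = j]).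
  by apply/seteqP; split=> [y Ey|y [j _ []] //]; exists (digit_head y).
apply: fin_bigcup_measurable => // j _; rewrite cons_image_head.
exact: measurable_cons_image.
Qed.

Lemma unit_leb_digits (E : set Y) : measurable E ->
  unit_leb E = (k%:R^-1%:E * \sum_j unit_leb (digit_cons j @^-1` E))%E.
Proof.
move=> mE; rewrite (measure_fibers _ (p := digit_head)); last first.
  by move=> j; rewrite cons_image_head; apply: measurable_cons_image;
    exact: measurable_cons_preimage.
rewrite ge0_sume_distrr //; apply: eq_bigr => j _; rewrite cons_image_head.
by apply: unit_leb_cons; exact: measurable_cons_preimage.
Qed.

End Digits.

Arguments digit_cons {R k} k_gt1 j y : simpl never.
Arguments digit_head {R k} k_gt1 y : simpl never.
Arguments digit_tail {R k} k_gt1 y : simpl never.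

(** * A zero-one law for families of equal measure stable under stripping a digit *)

Section DigitZeroOne.
Context (R : realType) (k : nat).
Hypothesis k_gt1 : (1 < k)%N.
Local Notation Y := (unit_interval R).
Local Notation leb := (@lebesgue_measure R).
Local Notation dcons := (@digit_cons R _ k_gt1).
Context (Q : set (set Y)) (e : R).
Hypotheses (mQ : forall E, Q E -> measurable E)
  (Qe : forall E, Q E -> unit_leb E = e%:E)
  (Qcons : forall E j, Q E -> Q (dcons j @^-1` E)).

Let below (x : Y) : set Y := [set y | uval y < uval x].

Let mbelow x : measurable (below x).
Proof.
rewrite (_ : below x = @uval R @^-1` `]-oo, uval x[%classic).
  exact: measurable_uval.
by apply/seteqP; split=> y /=; rewrite in_itv.
Qed.

Let e01 E : Q E -> 0 <= e <= 1.
Proof.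
move=> QE; rewrite -!lee_fin -(Qe QE) measure_ge0 /=; apply: probability_le1.
exact: mQ.
Qed.

(** How far [E] is from being spread with constant density [e] over the points below [x]. *)
Let discrepancy E x := fine (unit_leb (E `&` below x)) - e * uval x.

(** Every set obtained by stripping a digit again has measure [e], so the first-digit intervals
    entirely below [x] show no deviation. Only the one containing [x] does, at scale [k^-1]. *)
Let discrepancy_step E x : Q E -> discrepancy E x =
  k%:R^-1 * discrepancy (dcons (digit_head k_gt1 x) @^-1` E)
                        (digit_tail k_gt1 x).
Proof.
move=> QE; set h := digit_head k_gt1 x; set t := digit_tail k_gt1 x.
have mE j : measurable (dcons j @^-1` E) by apply: mQ; exact: Qcons.
have k0 : k%:R != 0 :> R by rewrite pnatr_eq0 -lt0n ltnW.
have lebE : unit_leb (E `&` below x) =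
    (k%:R^-1 * (h%:R * e + fine (unit_leb (dcons h @^-1` E `&` below t))))%:E.
  rewrite (unit_leb_digits k_gt1); last exact: measurableI (mQ QE) (mbelow x).
  rewrite (eq_bigr (fun j : 'I_k => ((if (j < h)%N then e else 0) + if j == h
    then fine (unit_leb (dcons h @^-1` E `&` below t)) else 0)%:E)); last first.
    move=> j _; rewrite preimage_setI.
    have -> : dcons j @^-1` below x =
        [set y | (j < h)%N || (j == h) && (uval y < uval t)].
      by apply/seteqP; split=> y; rewrite /preimage /below /= (digit_cons_lt k_gt1).
    case: (ltngtP j h) => [jh|jh|/val_inj ->].
    - rewrite (_ : (j == h) = false) /=; last by rewrite -val_eqE /= ltn_eqF.
      rewrite (_ : [set y | true] = setT) ?setIT; last by apply/seteqP; split.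
      by rewrite (Qe (Qcons j QE)) addr0.
    - rewrite (_ : (j == h) = false) /=; last by rewrite -val_eqE /= gtn_eqF.
      rewrite (_ : [set y | false] = set0) ?setI0; last by apply/seteqP; split.
      by rewrite measure0 addr0.
    - rewrite eqxx /= add0r fineK // fin_num_measure //.
      exact: measurableI.
  rewrite sumEFin -EFinM big_split /= -big_mkcond /= -big_mkcond /= big_pred1_eq.
  rewrite -(big_ord_widen k (fun=> e)) ?(ltnW (ltn_ord h)) //.
  by rewrite sumr_const card_ord -(mulr_natl e).
rewrite /discrepancy lebE /= -[in e * uval x](digit_consK k_gt1 x).
by rewrite uval_digit_cons -/h -/t; field.
Qed.

(** Each step divides the trivial bound 1 by [k], uniformly over [Q], which is why [E] and [x] are
    quantified inside the induction. *)
Let discrepancy_le n : forall E x, Q E -> `|discrepancy E x| <= k%:R ^- n.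
Proof.
elim: n => [|n IH] E x QE.
  have /andP[e0 e1] := e01 QE; have /andP[x0 x1] := uval_itv x.
  have : 0 <= fine (unit_leb (E `&` below x)) by exact: fine_ge0.
  have : fine (unit_leb (E `&` below x)) <= 1.
    rewrite -lee_fin fineK ?probability_le1 //; first exact: measurableI (mQ QE) _.
    by rewrite fin_num_measure //; exact: measurableI (mQ QE) _.
  have : 0 <= e * uval x by exact: mulr_ge0.
  have : e * uval x <= 1 by apply: mulr_ile1 => //; exact: ltW.
  by rewrite expr0 invr1 ler_norml /discrepancy; lra.
rewrite (discrepancy_step _ QE) normrM normfV normr_nat exprS invfM.
by rewrite ler_wpM2l ?invr_ge0 // IH //; exact: Qcons.
Qed.

Let discrepancy0 E x : Q E -> discrepancy E x = 0.
Proof.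
move=> QE; apply/eqP; rewrite -normr_le0; apply/ler_addgt0Pr => eps eps0.
rewrite add0r; have [n hn] : exists n, eps^-1 < n%:R.
  by exists (Num.truncn eps^-1).+1; exact: truncnS_gt.
apply: (le_trans (discrepancy_le n x QE)).
have nk : n%:R < k%:R ^+ n :> R by rewrite -natrX ltr_nat ltn_expl.
rewrite invf_ple ?posrE ?exprn_gt0 ?ltr0n ?(ltnW k_gt1) //.
by rewrite ltW // (lt_trans hn).
Qed.

(** Vanishing discrepancy means that [E] meets every Borel set [B] in the proportion [e] of its part
    in the unit interval. Taking [B = E] gives [e = e * e]. *)
Lemma digit_zero_one E : Q E -> unit_leb E = 0%E \/ unit_leb E = 1%E.
Proof.
move=> QE; have /andP[e0 e1] := e01 QE.
have mA : measurable (@uval R @` E : set (measurableTypeR R)) by exact: mQ.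
pose I01 : set (measurableTypeR R) := `[0, 1[%classic.
have mI : measurable I01 by exact: measurable_itv.
have below_itv (y : Y) : @uval R @` (E `&` below y) =
    `]-oo, uval y[%classic `&` @uval R @` E.
  apply/seteqP; split=> [_ [z [Ez zy] <-]|z [/=]].
    by split; [rewrite /= in_itv|exists z].
  rewrite in_itv /= => zy [w Ew wz]; exists w => //; split=> //=.
  by rewrite /below /= wz.
have unif B : measurable B ->
    leb (B `&` @uval R @` E) = (e%:E * leb (B `&` I01))%E.
  move=> mB.
  (* The open left rays form a pi-system generating the Borel sets, so the two measures need only be
     compared on rays. *)
  have := @measure_unique _ R (measurableTypeR R) (@RGenInftyO.G R)
    (fun n => `]-oo, n%:R[%classic) _ _ _ _
    (mrestr leb mA) (mscale (NngNum e0) (mrestr leb mI)) _ _ B mB.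
  apply.
  - exact: RGenInftyO.measurableE.
  - move=> _ _ [x ->] [y ->]; exists (Num.min x y).
    apply/seteqP; split=> z /=; rewrite !in_itv /= lt_min; first by case=> -> ->.
    by move=> /andP[].
  - by move=> i; exists i%:R.
  - apply/seteqP; split=> // x _; exists (Num.truncn x).+1 => //=.
    by rewrite in_itv /= truncnS_gt.
  - move=> _ [x ->].
    rewrite -[LHS]/(leb (`]-oo, x[ `&` @uval R @` E)).
    rewrite -[RHS]/(e%:E * leb (`]-oo, x[ `&` I01))%E.
    have [x0|x0] := leP x 0.
      rewrite (_ : _ `&` _ = set0) ?measure0; last first.
        apply/seteqP; split=> // z [/=]; rewrite in_itv /= => zx [y _ yz].
        have /andP[y0 _] := uval_itv y.
        by move: zx; rewrite -yz ltNge (le_trans x0 y0).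
      rewrite (_ : _ `&` _ = set0) ?measure0 ?mule0 //.
      apply/seteqP; split=> // z []; rewrite /I01 /= !in_itv /= => zx /andP[z0 _].
      by move: zx; rewrite ltNge (le_trans x0 z0).
    have [x1|x1] := ltP x 1.
      have x01 : 0 <= x < 1 by rewrite ltW.
      have xE : x = uval (to_unit x01) by [].
      rewrite [in LHS]xE -below_itv.
      have -> : `]-oo, x[%classic `&` I01 = `[0, x[%classic.
        apply/seteqP; split=> z; rewrite /I01 /= !in_itv /=.
          by move=> [zx /andP[-> _]].
        by move=> /andP[-> zx]; rewrite zx (lt_trans zx x1).
      rewrite lebesgue_measure_itv /= lte_fin x0 sube0 -EFinM.
      have /eqP := discrepancy0 (to_unit x01) QE.
      rewrite /discrepancy subr_eq0 => /eqP <-; rewrite fineK //.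
      by rewrite fin_num_measure //; exact: measurableI (mQ QE) _.
    rewrite (setIidr (_ : @uval R @` E `<=` _)); last first.
      move=> _ [y _ <-] /=; rewrite in_itv /=; have /andP[_ y1] := uval_itv y.
      exact: lt_le_trans y1 x1.
    rewrite (setIidr (_ : I01 `<=` _)); last first.
      by move=> z; rewrite /I01 /= !in_itv /= => /andP[_ z1]; exact: lt_le_trans z1 x1.
    rewrite lebesgue_measure_itv /= lte01 sube0 mule1.
    exact: Qe.
  - move=> n; rewrite -[X in (X < _)%E]/(leb (`]-oo, n%:R[ `&` @uval R @` E)).
    apply: le_lt_trans (ltry 1).
    apply: (@le_trans _ _ (leb (@uval R @` E))).
      apply: le_measure => //; apply/mem_set => //.
      exact: (measurableI _ _ (measurable_itv _) mA).
    rewrite -[leb _]/(unit_leb E) Qe // lee_fin //.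
have := unif _ mA; rewrite setIid (setIidl (_ : _ `<=` I01)); last first.
  by rewrite /I01 -range_uval; apply: image_subset.
rewrite -[leb _]/(unit_leb E) Qe // -EFinM => -[] /eqP.
rewrite -subr_eq0 -{1}[e]mulr1 -mulrBr mulf_eq0 subr_eq0.
by move=> /orP[/eqP ->|/eqP <-]; [left|right].
Qed.

End DigitZeroOne.

(** * Actions on finitely many copies of the unit interval *)

(** The index [p0] supplies the base point of the type. *)
Definition pieces (P : finType) (p0 : P) (R : realType) : Type :=
  (P * unit_interval R)%type.

Section Pieces.
Context (P : finType) (p0 : P) (R : realType).
Local Notation Y := (unit_interval R).
Local Notation X := (pieces p0 R).

HB.instance Definition _ := Choice.on X.
HB.instance Definition _ := isPointed.Build X (p0, point : Y).

Definition piece_section (A : P) (E : set X) : set Y := [set y | E (A, y)].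

Definition pieces_measurable : set (set X) :=
  [set E | forall A, measurable (piece_section A E)].

Let pieces_measurable0 : pieces_measurable set0.
Proof. by move=> A; exact: measurable0. Qed.

Let pieces_measurableC E : pieces_measurable E -> pieces_measurable (~` E).
Proof. by move=> mE A; apply: measurableC; exact: mE. Qed.

Let pieces_measurable_bigcup (F : (set X)^nat) :
  (forall i, pieces_measurable (F i)) -> pieces_measurable (\bigcup_i F i).
Proof.
move=> mF A; rewrite (_ : piece_section A _ = \bigcup_i piece_section A (F i)).
  by apply: bigcup_measurable => i _; exact: mF.
by apply/seteqP; split.
Qed.

HB.instance Definition _ := @isMeasurable.Build default_measure_display
  X pieces_measurable pieces_measurable0 pieces_measurableC
  pieces_measurable_bigcup.

Lemma measurable_piece_section (E : set X) :
  measurable E -> forall A, measurable (piece_section A E).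
Proof. by move=> mE A; exact: mE. Qed.

Lemma measurable_pieces (E : set X) :
  (forall A, measurable (piece_section A E)) -> measurable E.
Proof. by move=> mE; exact: mE. Qed.

(* A piece carries either the whole unit interval or only the points below
   [delta]. *)
Record weights (delta : R) := Weights {
  weight :> P -> R;
  full : pred P;
  weight_ge0 : forall A, 0 <= weight A;
  weight_sum : \sum_A weight A * (if full A then 1 else delta) = 1;
  weight_delta : 0 <= delta <= 1 }.

Definition lower (delta : R) : set Y := [set y | uval y < delta].

Lemma measurable_lower delta : measurable (lower delta).
Proof.
rewrite (_ : lower delta = @uval R @^-1` `]-oo, delta[%classic).
  exact: measurable_uval.
by apply/seteqP; split=> y /=; rewrite in_itv.
Qed.

Lemma unit_leb_lower delta : 0 <= delta <= 1 ->
  unit_leb (lower delta) = delta%:E.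
Proof.
move=> /andP[d0 d1]; rewrite /unit_leb.
have -> : @uval R @` lower delta = `[0, delta[%classic.
  apply/seteqP; split=> [_ [y yd <-]|x] /=; rewrite in_itv /=.
    by have /andP[-> _] := uval_itv y.
  move=> /andP[x0 xd]; have x01 : 0 <= x < 1 by rewrite x0 (lt_le_trans xd).
  by exists (to_unit x01).
rewrite lebesgue_measure_itv /= lte_fin; case: ltP => [_|d0'].
  by rewrite sube0.
by congr EFin; apply/eqP; rewrite eq_le d0 d0'.
Qed.

Section PieceMeasure.
Context (delta : R) (W : weights delta).

Definition cell (A : P) : set Y := if full W A then setT else lower delta.

Lemma measurable_cell A : measurable (cell A).
Proof. by rewrite /cell; case: ifP => // _; exact: measurable_lower. Qed.

Definition piece_measure (E : set X) : \bar R :=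
  (\sum_A (W A)%:E * unit_leb (piece_section A E `&` cell A))%E.

Let piece_measure0 : piece_measure set0 = 0%E.
Proof.
rewrite /piece_measure big1 // => A _.
rewrite (_ : _ `&` _ = set0) ?measure0 ?mule0 //.
by apply/seteqP; split=> // y [].
Qed.

Let piece_measure_ge0 E : (0 <= piece_measure E)%E.
Proof.
by apply: sume_ge0 => A _; rewrite mule_ge0 ?lee_fin ?weight_ge0 ?measure_ge0.
Qed.

Let piece_measure_sigma_additive : semi_sigma_additive piece_measure.
Proof.
move=> F mF tF _.
rewrite (_ : (fun n => _) = fun n => (\sum_A \sum_(0 <= i < n)
    (W A)%:E * unit_leb (piece_section A (F i) `&` cell A))%E); last first.
  by apply/funext => n; rewrite exchange_big.
apply: cvg_nnesum => [A _|A _].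
  near=> n; apply: sume_ge0 => i _.
  by rewrite mule_ge0 ?lee_fin ?weight_ge0 ?measure_ge0.
under eq_fun do rewrite -ge0_sume_distrr //.
apply: cvgeZl => //.
rewrite (_ : _ `&` _ = \bigcup_i (piece_section A (F i) `&` cell A)); last first.
  by rewrite -setI_bigcupl; congr setI; apply/seteqP; split.
apply: measure_semi_sigma_additive.
- by move=> i; apply: measurableI; [exact: mF|exact: measurable_cell].
- apply/trivIsetP => i j _ _ ij; apply/seteqP; split=> // y [[/= Fi _] [/= Fj _]].
  have : (F i `&` F j) (A, y) by split.
  by move/trivIsetP: tF => /(_ i j I I ij) ->.
- apply: bigcup_measurable => i _.
  by apply: measurableI; [exact: mF|exact: measurable_cell].
Unshelve. all: by end_near. Qed.

HB.instance Definition _ := isMeasure.Build _ _ _ piece_measure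
  piece_measure0 piece_measure_ge0 piece_measure_sigma_additive.

Let piece_measureT : piece_measure setT = 1%E.
Proof.
rewrite /piece_measure -(weight_sum W) -sumEFin; apply: eq_bigr => A _.
rewrite EFinM; congr (_ * _)%E; rewrite (_ : piece_section A setT = setT) //.
rewrite setTI /cell; case: ifP => _; first exact: probability_setT.
exact: unit_leb_lower (weight_delta W).
Qed.

HB.instance Definition _ := Measure_isProbability.Build _ _ _ piece_measure
  piece_measureT.

End PieceMeasure.
End Pieces.

(** * Densities constant on the parts of a finite partition *)

Section FiberwiseDensity.
Context (R : realType) (d : measure_display) (X : measurableType d).
Context (eta : {finite_measure set X -> \bar R}) (I : finType) (p : X -> I).
Hypothesis mp : forall i, measurable [set x | p x = i].

Lemma integral_fibers (c : I -> R) (E : set X) : measurable E ->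
  (\int[eta]_(x in E) (c (p x))%:E =
   \sum_i (c i)%:E * eta (E `&` [set x | p x = i]))%E.
Proof.
move=> mE; pose F1 i (x : X) : \bar R :=
  ((c i)%:E * (\1_[set x | p x = i] x)%:E)%E.
have iF1 i : eta.-integrable E (F1 i).
  apply: integrableZl => //; apply: (integrableS measurableT) => //.
  exact: integrable_indic.
rewrite (eq_integral (fun x => \sum_i F1 i x)%E); last first.
  move=> x _; rewrite (bigD1 (p x)) //= /F1 indicE mem_set // mule1.
  rewrite big1 ?adde0 // => i ix; rewrite indicE memNset ?mule0 //= => xi.
  by rewrite xi eqxx in ix.
rewrite integral_sum //; apply: eq_bigr => i _; rewrite /F1 integralZl //.
  by rewrite integral_indic // setIC.
by apply: (integrableS measurableT) => //; exact: integrable_indic.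
Qed.

Lemma density_of_fibers (m : {measure set X -> \bar R}) (c : I -> R) :
  (forall i F, measurable F -> (forall x, F x -> p x = i) ->
    m F = ((c i)%:E * eta F)%E) ->
  forall E, measurable E -> m E = (\int[eta]_(x in E) (c (p x))%:E)%E.
Proof.
move=> mc E mE; rewrite integral_fibers // (measure_fibers _ (p := p)).
  apply: eq_bigr => i _; apply: mc; first exact: measurableI.
  by move=> x [].
by move=> i; exact: measurableI.
Qed.

End FiberwiseDensity.

(* How a letter moves a piece [A]: it is cut along the first digit and spread
   over the pieces [t j], or squeezed into the [j]-th part of [B], or its points
   are sent at the same height to the pieces [f true] (below delta) and
   [f false]. *)
Variant motion (P : Type) (k : nat) :=
  | Expand of ('I_k -> P)
  | Contract of P & 'I_k
  | Slide of (bool -> P).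

Arguments Expand {P k}. Arguments Contract {P k}. Arguments Slide {P k}.

Section Motions.
Context (R : realType) (k : nat) (k_gt1 : (1 < k)%N) (P : finType) (p0 : P).
Context (delta : R).
Local Notation Y := (unit_interval R).
Local Notation X := (pieces p0 R).
Local Notation dcons := (@digit_cons R _ k_gt1).

Definition move_points (md : P -> motion P k) (x : X) : X :=
  match md x.1 with
  | Expand t => (t (digit_head k_gt1 x.2), digit_tail k_gt1 x.2)
  | Contract B j => (B, dcons j x.2)
  | Slide f => (f (uval x.2 < delta), x.2)
  end.

(** A condition on the finite tables alone: expanding is undone by contracting into the matching
    part, and conversely, while a slide is undone by a slide on the same side of [delta]. *)
Definition inverse_motions (md md' : P -> motion P k) := forall A,
  match md A with
  | Expand t => forall j, md' (t j) = Contract A j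
  | Contract B j => exists2 t, md' B = Expand t & t j = A
  | Slide f => forall b, exists2 f', md' (f b) = Slide f' & f' b = A
  end.

Lemma move_pointsK md md' : inverse_motions md md' ->
  cancel (move_points md) (move_points md').
Proof.
move=> inv [A y]; have := inv A; rewrite {2}/move_points /=.
case: (md A) => [t|B j|f] /=.
- by rewrite /move_points /= => ->; rewrite digit_consK.
- move=> [t Bt tA]; rewrite /move_points /= Bt.
  by rewrite digit_head_cons digit_tail_cons tA.
- by move=> /(_ (uval y < delta)) [f' ff' fA]; rewrite /move_points /= ff' fA.
Qed.

Lemma measurable_move_points md : measurable_fun setT (move_points md).
Proof.
move=> _ E /measurable_piece_section mE; rewrite setTI.
apply: measurable_pieces => A.
rewrite /piece_section /move_points /=; case: (md A) => [t|B j|f] /=.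
- refine (@measurable_digits R k k_gt1 _ _) => j.
  rewrite (_ : _ @^-1` _ = piece_section (t j) E) //.
  by apply/seteqP; split=> y /=; rewrite digit_head_cons digit_tail_cons.
- exact: measurable_cons_preimage (mE B).
- rewrite (_ : [set y | _] = (lower delta `&` piece_section (f true) E) `|`
      (~` lower delta `&` piece_section (f false) E)).
    exact: (measurableU _ _ (measurableI _ _ (measurable_lower _) (mE _))
      (measurableI _ _ (measurableC (measurable_lower _)) (mE _))).
  apply/seteqP; split=> y /=; rewrite /lower /piece_section /=.
    case: (boolP (uval y < delta)) => yd Ey; [by left|right].
    by split=> //; apply/negP.
  by move=> [[-> //]|[/negP/negbTE -> //]].
Qed.

Context (W : weights P delta).

(** These are mass balances for density [v A] on [A]. A part cut along the first digit has [k^-1] of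
    the mass of its piece, whence the factors [k]; a slide preserves heights, so only the weights
    are compared, and above [delta] both pieces must be present or both absent. *)
Definition motion_density (md : P -> motion P k) (v : P -> R) := forall A,
  match md A with
  | Expand t => full W A /\
      forall j, full W (t j) /\ W (t j) * k%:R = v A * W A
  | Contract B j => [/\ full W A, full W B & W B = v A * W A * k%:R]
  | Slide f => (forall b, W (f b) = v A * W A) /\
      full W (f false) = full W A
  end.

Lemma piece_measure_one_piece (A : P) (E : set X) :
  (forall x, E x -> x.1 = A) ->
  piece_measure W E = ((W A)%:E * unit_leb (piece_section A E `&` cell W A))%E.
Proof.
move=> EA; rewrite /piece_measure (bigD1 A) //= big1 ?adde0 // => B BA.
rewrite (_ : _ `&` _ = set0) ?measure0 ?mule0 //.
apply/seteqP; split=> // y [/= /EA /= BA' _].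
by rewrite BA' eqxx in BA.
Qed.

Lemma piece_measure_move md md' v (E : set X) :
  cancel (move_points md) (move_points md') ->
  cancel (move_points md') (move_points md) ->
  motion_density md v -> measurable E ->
  piece_measure W (move_points md @` E) =
  (\int[piece_measure W]_(x in E) (v x.1)%:E)%E.
Proof.
move=> TK T'K dens mE.
have k0 : k%:R != 0 :> R by rewrite pnatr_eq0 -lt0n ltnW.
(* On each part of this finer partition the move is given by a single formula with a single target
   piece. *)
pose p (x : X) := (x.1, digit_head k_gt1 x.2, uval x.2 < delta).
have imE F : move_points md @` F = move_points md' @^-1` F.
  apply/seteqP; split=> [_ [x Fx <-]|x Fx] /=; first by rewrite TK.
  by exists (move_points md' x).
have mT' := @measurable_move_points md'.
have -> : piece_measure W (move_points md @` E) =
    pushforward (piece_measure W) (move_points md') E by rewrite imE.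
have := @density_of_fibers R _ X (piece_measure W) _ p _
  (pushforward (piece_measure W) (move_points md')) (fun i => v i.1.1).
apply => //.
  move=> [[A j] b]; apply: measurable_pieces => B; rewrite /piece_section /=.
  have [->|AB] := eqVneq B A; last first.
    rewrite (_ : [set y | _] = set0) //; apply/seteqP; split=> // y /= [BA].
    by rewrite BA eqxx in AB.
  rewrite (_ : [set y | _] = digit_cons k_gt1 j @` setT `&`
     (if b then lower delta else ~` lower delta)).
    apply: measurableI; first exact: measurable_cons_image.
    by case: b; [|apply: measurableC]; exact: measurable_lower.
  apply/seteqP; split=> [y [<- <-]|_ [[y _ <-] yb]].
    split; first by exists (digit_tail k_gt1 y); rewrite ?digit_consK.
    by rewrite /lower; case: ifP => //= /negbT/negP.
  rewrite /p /= digit_head_cons; congr (_, _, _).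
  by case: b yb => /=; [|move=> /negP/negbTE].
move=> [[A j] b] F mF Fp /=; rewrite /pushforward -imE.
have FA x : F x -> x.1 = A by move=> /Fp [].
have Fj y : F (A, y) -> digit_head k_gt1 y = j by move=> /Fp [].
have Fb y : F (A, y) -> (uval y < delta) = b by move=> /Fp [].
have mS := measurable_piece_section mF A.
set S := piece_section A F in mS *.
rewrite (piece_measure_one_piece FA) -/S.
have image_one B (phi : Y -> Y) :
    (forall y, F (A, y) -> move_points md (A, y) = (B, phi y)) ->
    piece_measure W (move_points md @` F) =
    ((W B)%:E * unit_leb (phi @` S `&` cell W B))%E.
  move=> Tphi; rewrite (piece_measure_one_piece (A := B)).
    congr (_ * unit_leb (_ `&` _))%E; apply/seteqP; split=> y.
      move=> [[A' z] Fz]; have A'A := FA _ Fz; rewrite /= in A'A.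
      by move: Fz; rewrite A'A => Fz; rewrite Tphi // => -[zy]; exists z.
    by move=> [z Fz <-]; exists (A, z) => //; exact: Tphi.
  move=> _ [[A' z] Fz <-]; have A'A := FA _ Fz; rewrite /= in A'A.
  by move: Fz; rewrite A'A => Fz; rewrite Tphi.
have := dens A; case mdA: (md A) => [t|B i|f].
- move=> [fA /(_ j) [ftj wtj]].
  rewrite (image_one (t j) (digit_tail k_gt1)); last first.
    by move=> y /Fj yj; rewrite /move_points /= mdA yj.
  rewrite /cell fA ftj !setIT.
  have -> : digit_tail k_gt1 @` S = dcons j @^-1` S.
    apply/seteqP; split=> [_ [y Sy <-]|y Sy] /=.
      by rewrite -(Fj _ Sy) digit_consK.
    by exists (dcons j y); rewrite // digit_tail_cons.
  have SE : S = dcons j @` (dcons j @^-1` S).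
    apply/seteqP; split=> [y Sy|_ [y Sy <-] //].
    by exists (digit_tail k_gt1 y); rewrite /= -(Fj _ Sy) digit_consK.
  rewrite [in RHS]SE unit_leb_cons; last exact: measurable_cons_preimage.
  by rewrite !muleA -!EFinM -wtj mulfK.
- move=> [fA fB wB]; rewrite (image_one B (dcons i)); last first.
    by move=> y _; rewrite /move_points /= mdA.
  rewrite /cell fA fB !setIT unit_leb_cons // !muleA -!EFinM wB.
  by rewrite mulfK.
- move=> [wf ff]; rewrite (image_one (f b) id); last first.
    by move=> y /Fb yb; rewrite /move_points /= mdA yb.
  rewrite wf image_id muleA -EFinM; congr (_ * unit_leb _)%E.
  (* Points below [delta] lie in every cell, so fullness has to be compared only for [f false]. *)
  case: b Fp Fb {image_one} => Fp Fb.
    rewrite !setIidl //; move=> y Sy; rewrite /cell; case: ifP => // _;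
      exact: Fb.
  by rewrite /cell ff.
Qed.

End Motions.

(** * Stationarity, entropy and ergodicity of piecewise actions *)

Section PieceAction.
Context (R : realType) (G : groupType) (r : nat) (s : 'I_r -> G).
Local Notation L := ('I_r * bool)%type.
Local Notation k := (r * 2).-1.
Hypotheses (r_gt1 : (1 < r)%N) (hs : freely_generates s).
Context (k_gt1 : (1 < k)%N) (P : finType) (p0 : P) (delta : R)
  (W : weights P delta).
Context (md : L -> P -> motion P k).
Hypothesis md_inv : forall l, inverse_motions (md l) (md (inv_letter l)).
Local Notation mu := (@uniform_on R G (generators_and_inverses s)).
Local Notation X := (pieces p0 R).
Local Notation T := (fun l => @move_points R k k_gt1 P p0 delta (md l)).

Lemma piece_action_proof l : cancel (T l) (T (inv_letter l)).
Proof. exact: move_pointsK. Qed.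

Definition piece_action : measurable_action G X :=
  free_action hs piece_action_proof
    (fun l => @measurable_move_points R k k_gt1 P p0 delta (md l)).

Lemma piece_action_letter l x : piece_action (letter s l) x = T l x.
Proof. exact: free_act_letter piece_action_proof l x. Qed.

Let eta : probability X R := piece_measure W.

Lemma measurable_on_pieces (c : P -> R) :
  measurable_fun setT (fun x : X => c x.1).
Proof.
move=> _ B mB; rewrite setTI; apply: measurable_pieces => A.
have [cB|cB] := pselect (B (c A)).
  rewrite (_ : piece_section _ _ = setT) //.
  by apply/seteqP; split.
by rewrite (_ : piece_section _ _ = set0) //; apply/seteqP; split.
Qed.

Lemma measurable_piece (A : P) : measurable [set x : X | x.1 = A].
Proof.
apply: measurable_pieces => B; rewrite /piece_section /=.
have [->|BA] := eqVneq B A.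
  by rewrite (_ : [set y | _] = setT) //; apply/seteqP; split.
rewrite (_ : [set y | _] = set0) //; apply/seteqP; split=> // y /= e.
by rewrite e eqxx in BA.
Qed.

Lemma piece_measure_piece (A : P) : eta [set x : X | x.1 = A] =
  (W A * (if full W A then 1 else delta))%:E.
Proof.
rewrite -[LHS]/(piece_measure W _) (piece_measure_one_piece W (A := A)) //.
rewrite (_ : piece_section _ _ = setT) ?setTI; last by apply/seteqP; split.
rewrite EFinM /cell; congr (_ * _)%E; case: ifP => _.
  exact: probability_setT.
exact: unit_leb_lower (weight_delta W).
Qed.

Context (v : L -> P -> R) (c : R).
Hypotheses (c_gt0 : 0 < c) (v_bounds : forall l A, c^-1 <= v l A <= c)
  (v_density : forall l, motion_density W (md l) (v l))
  (v_sum : forall A, \sum_l v l A = (r * 2)%:R).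

Let r_gt0 : (0 < r)%N. Proof. exact: ltnW. Qed.

Lemma translate_piece_action l (E : set X) : measurable E ->
  translate piece_action eta (letter s l) E =
  (\int[eta]_(x in E) (v l x.1)%:E)%E.
Proof.
move=> mE; rewrite -(piece_measure_move (md := md l) (md' := md (inv_letter l))
  (k_gt1 := k_gt1)) //.
- rewrite /translate; congr (eta _).
  by apply: eq_imagel => x _; exact: piece_action_letter.
- exact: piece_action_proof.
- rewrite -{2}(inv_letterK l); exact: piece_action_proof.
Qed.

(** On every piece the densities of the letters sum to their number, so averaging the translates
    returns [eta]. *)
Lemma stationary_piece_action : stationary mu piece_action eta.
Proof.
apply/(stationaryP r_gt1 hs) => E mE.
have nuE l : fine (translate piece_action eta (letter s l) E) =
    \sum_A v l A * fine (eta (E `&` [set x | x.1 = A])).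
  rewrite translate_piece_action // integral_fibers //; last exact: measurable_piece.
  rewrite -[RHS]/(fine _%:E) -sumEFin; congr fine; apply: eq_bigr => A _.
  rewrite EFinM fineK // fin_num_measure //; apply: measurableI => //.
  exact: measurable_piece.
under eq_bigr do rewrite nuE.
rewrite exchange_big /=.
under eq_bigr do rewrite -mulr_suml v_sum.
rewrite -mulr_sumr mulrA mulVf ?mul1r; last first.
  by rewrite pnatr_eq0 muln_eq0 eqn0Ngt r_gt0.
rewrite (measure_fibers eta (p := fun x : X => x.1)); last first.
  by move=> A; apply: measurableI => //; exact: measurable_piece.
rewrite -sumEFin; apply: eq_bigr => A _.
rewrite fineK // fin_num_measure //; apply: measurableI => //.
exact: measurable_piece.
Qed.

Lemma entropy_piece_action : furstenberg_entropy mu piece_action eta =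
  ((r * 2)%:R^-1 * \sum_A W A * (if full W A then 1 else delta) *
    \sum_l - ln (v l A))%:E.
Proof.
rewrite (@entropy_of_density R G r s r_gt0 hs _ X piece_action eta
  (fun l (x : X) => v l x.1) c c_gt0).
- congr (_ * _)%:E.
  transitivity (\sum_l \sum_A - ln (v l A) * (W A * (if full W A then 1 else delta))).
    apply: eq_bigr => l _; rewrite /Rintegral.
    rewrite (integral_fibers _ measurable_piece (fun A => - ln (v l A))) //.
    rewrite -[RHS]/(fine _%:E) -sumEFin; congr fine; apply: eq_bigr => A _.
    rewrite setTI EFinM; congr (_ * _)%E; exact: piece_measure_piece.
  rewrite exchange_big /=; apply: eq_bigr => A _.
  by rewrite mulr_sumr; apply: eq_bigr => l _; rewrite mulrC.
- by move=> l; exact: (measurable_on_pieces (v l)).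
- by move=> l x; exact: v_bounds.
- exact: translate_piece_action.
Qed.

(* The sections of an invariant set over the core pieces satisfy the hypotheses
   of [digit_zero_one]: stripping a digit amounts to passing to a successor. *)
Lemma ergodic_piece_action (core : pred P) (succ : P -> 'I_k -> P) :
  (forall A j, core A -> core (succ A j)) ->
  (forall A j y, core A -> exists g,
     piece_action g (A, digit_cons k_gt1 j y) = (succ A j, y)) ->
  (forall e : P -> R,
     (forall A, core A -> e A = k%:R^-1 * \sum_j e (succ A j)) ->
     forall A B, core A -> core B -> e A = e B) ->
  (forall A, W A = 0 \/ core A \/ full W A = false /\ exists2 B, core B &
     forall y, lower delta y -> exists g, piece_action g (A, y) = (B, y)) ->
  ergodic piece_action eta.
Proof.
move=> core_succ succP irred pieceP E mE invE.
(* A piece outside the core either has weight 0 or carries only its points below [delta], and these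
   are moved at the same height to a core piece, where the invariant set is null. *)
have null_of F : measurable F -> (forall g, piece_action g @` F = F) ->
    (forall A, core A -> unit_leb (piece_section A F) = 0%E) -> eta F = 0%E.
  move=> mF invF F0; rewrite -[eta F]/(piece_measure W F) /piece_measure.
  have mSF A := measurable_piece_section mF A.
  have mcW A : measurable (cell W A) by exact: measurable_cell.
  rewrite big1 // => A _; have [->|[cA|[fA [B cB AB]]]] := pieceP A.
  - by rewrite mul0e.
  - rewrite (_ : unit_leb _ = 0%E) ?mule0 //; apply/eqP.
    rewrite eq_le measure_ge0 andbT -(F0 A cA).
    apply: le_measure; rewrite ?inE //; apply/mem_set => //.
    exact: measurableI.
  - rewrite (_ : unit_leb _ = 0%E) ?mule0 //; apply/eqP.
    rewrite eq_le measure_ge0 andbT -(F0 B cB).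
    apply: le_measure; rewrite ?inE //; try by apply/mem_set.
      by apply/mem_set; exact: measurableI.
    move=> y [Fy]; rewrite /cell fA => /AB [g gy].
    by rewrite /piece_section /= -(invF g) -gy; exists (A, y).
have invP F : (forall g, piece_action g @` F = F) ->
    forall g x, F (piece_action g x) <-> F x.
  move=> invF g x; split=> Fx; last by rewrite -(invF g); exists x.
  rewrite -(act1 piece_action x) -(mulVg g) actM -(invF (g^-1)%g).
  by exists (piece_action g x).
have secE A j : core A -> digit_cons k_gt1 j @^-1` piece_section A E =
    piece_section (succ A j) E.
  move=> cA; apply/seteqP; split=> y; rewrite /piece_section /=;
    have [g gy] := succP A j y cA; rewrite -gy.
    by move=> Ey; apply/(invP _ invE).
  by move/(invP _ invE).
pose e A := fine (unit_leb (piece_section A E)).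
have mSE A := measurable_piece_section mE A.
have eE A : unit_leb (piece_section A E) = (e A)%:E.
  by rewrite /e fineK // fin_num_measure.
(* Cutting a section along its first digit shows that [e] is the average of its values at the
   successors, so [irred] applies. *)
have e_const : forall A B, core A -> core B -> e A = e B.
  apply: irred => A cA; rewrite /e (unit_leb_digits k_gt1) //.
  under eq_bigr do rewrite secE // eE.
  by rewrite sumEFin.
have [[A0 cA0]|noc] := pselect (exists A, core A); last first.
  left; apply: null_of => // A cA; exfalso; apply: noc; by exists A.
have zo A : core A -> unit_leb (piece_section A E) = 0%E \/
    unit_leb (piece_section A E) = 1%E.
  move=> cA; apply: (@digit_zero_one R k k_gt1
    [set S | exists2 B, core B & S = piece_section B E] (e A0)).
  - by move=> _ [B _ ->].
  - by move=> _ [B cB ->]; rewrite eE (e_const B A0).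
  - by move=> _ j [B cB ->]; exists (succ B j); rewrite ?secE //; exact: core_succ.
  - by exists A.
have [z|o] := zo A0 cA0.
  left; apply: null_of => // A cA; rewrite eE (e_const A A0) //.
  by move: z; rewrite eE.
(* The common measure of the sections over the core is now 1, so the complement, which is invariant
   too, is null over the core. *)
right; have : eta (~` E) = 0%E.
  apply: null_of => [|g|A cA]; first exact: measurableC.
    apply/seteqP; split=> [_ [x Ex <-]|x Ex].
      by move=> /(invP _ invE).
    exists (piece_action (g^-1)%g x); first by move=> /(invP _ invE).
    by rewrite -actM mulgV act1.
  rewrite (_ : piece_section A (~` E) = ~` piece_section A E) //.
  rewrite probability_setC // [X in (1 - X)%E](_ : _ = 1%E) ?subee //.
  by apply: etrans (eE A) _; rewrite (e_const A A0) // -eE.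
rewrite probability_setC // => /eqP; rewrite sube_eq ?fin_num_measure //.
by rewrite add0e => /eqP <-.
Qed.

End PieceAction.

(** * The system of maximal entropy *)

Section LetterDigits.
Context (r : nat).
Local Notation L := ('I_r * bool)%type.
Local Notation k := (r * 2).-1.
Hypothesis r_gt1 : (1 < r)%N.

Lemma card_letters : #|{: L}| = (r * 2)%N.
Proof. by rewrite card_prod card_ord card_bool. Qed.

Lemma digits_gt1 : (1 < k)%N.
Proof. by move: r_gt1; lia. Qed.

Let k_eq : k = #|{: L}|.-1.
Proof. by rewrite card_letters. Qed.

(** These are the letters that may follow [g] in a reduced word, numbered by ['I_k]: [lift] skips
    the inverse of [g]. *)
Definition next_letter (g : L) (j : 'I_k) : L :=
  enum_val (lift (enum_rank (inv_letter g)) (cast_ord k_eq j)).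

(** At [inv_letter g], which has no number, the value is a mere default. *)
Definition letter_digit (g l : L) : 'I_k :=
  if unlift (enum_rank (inv_letter g)) (enum_rank l) is Some i
  then cast_ord (esym k_eq) i else Ordinal (ltnW digits_gt1).

Lemma next_letter_neq g j : next_letter g j != inv_letter g.
Proof.
apply/eqP => /(congr1 enum_rank); rewrite /next_letter enum_valK => /eqP.
by rewrite eq_sym (negbTE (neq_lift _ _)).
Qed.

Lemma next_letterK g : cancel (next_letter g) (letter_digit g).
Proof.
move=> j; rewrite /letter_digit /next_letter enum_valK liftK.
exact: cast_ordK.
Qed.

Lemma letter_digitK g l : l != inv_letter g ->
  next_letter g (letter_digit g l) = l.
Proof.
move=> lg; rewrite /letter_digit /next_letter.
have := neq_lift; case: unliftP => [i|] e.
  by rewrite cast_ordKV -e enum_rankK.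
by move=> _; move/enum_rank_inj: e => e; rewrite e eqxx in lg.
Qed.

Lemma exists_third_letter (g h : L) : exists l, (l != g) && (l != h).
Proof.
have : (2 < #|{: L}|)%N by rewrite card_letters; move: r_gt1; lia.
rewrite (cardD1 g) (cardD1 h) !inE; move=> c.
have /card_gt0P[l] : (0 < #|[predD1 [predD1 {: L} & g] & h]|)%N.
  move: c; set n := #|_|; rewrite !andbT.
  by case: (h != g); rewrite /= ?add1n ?add0n ?ltnS // => /ltnW.
by rewrite !inE => /and3P[lh lg _]; exists l; rewrite lg lh.
Qed.

(** Maximum principle: where an average attains the maximum, so do all the averaged values. From a
    maximum point, two steps reach all letters, and [trans] then reaches the needed levels. *)
Lemma averaged_letter_const (R : realType) (K : finType) (next : K -> K)
    (e : K -> L -> R) (i0 : K) :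
  (forall i j, exists n, iter n.+2 next i = next j) ->
  (forall i h, e i h = k%:R^-1 * \sum_j e (next i) (next_letter h j)) ->
  forall i h i' h', e i h = e i' h'.
Proof.
move=> trans eE.
have k0 : k%:R != 0 :> R.
  by rewrite pnatr_eq0 -lt0n; move: digits_gt1; lia.
pose x0 : K * L := (i0, (Ordinal (ltnW r_gt1), false)).
pose x := [arg max_(y > x0) e y.1 y.2]%O.
have emax i h : e i h <= e x.1 x.2.
  by rewrite /x; case: Order.TotalTheory.arg_maxP => // y _ /(_ (i, h)); apply.
move: x emax => [i1 h1] /=; set c := e i1 h1 => emax.
have step i h : e i h = c -> forall l, l != inv_letter h -> e (next i) l = c.
  move=> eih l lh.
  have : \sum_j (c - e (next i) (next_letter h j)) = 0.
    rewrite sumrB sumr_const card_ord -mulr_natl -eih eE mulrA divff // mul1r.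
    by rewrite subrr.
  move/psumr_eq0P => e0; apply/esym/eqP; rewrite -subr_eq0.
  rewrite -(letter_digitK lh) e0 // => j _.
  by rewrite subr_ge0 emax.
(* An intermediate letter that cancels neither with [h1] nor with [l] leads to any [l] in two
   steps. *)
have step2 n l : e (iter n.+2 next i1) l = c.
  elim: n l => [|n IH] l /=.
    have [h /andP[hh1 hl]] := exists_third_letter (inv_letter h1) (inv_letter l).
    apply: (step _ h); first exact: (step _ h1).
    by apply: contraNneq hl => ->; rewrite inv_letterK.
  have [h /andP[hl _]] := exists_third_letter (inv_letter l) (inv_letter l).
  apply: (step _ h); first exact: IH.
  by apply: contraNneq hl => ->; rewrite inv_letterK.
(* The value at [i] is an average of values at [next i], so it suffices that [trans] reaches
   [next i]. *)
have all i h : e i h = c.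
  have [n nE] := trans i1 i.
  rewrite eE -nE (eq_bigr (fun=> c)) => [|j _]; last exact: step2.
  by rewrite sumr_const card_ord -(mulr_natl c) mulrA mulVf // mul1r.
by move=> i h i' h'; rewrite !all.
Qed.

End LetterDigits.
Section MaximalEntropy.
Context (R : realType) (G : groupType) (r : nat) (s : 'I_r -> G).
Local Notation L := ('I_r * bool)%type.
Local Notation k := (r * 2).-1.
Hypotheses (r_gt1 : (1 < r)%N) (hs : freely_generates s).
Local Notation mu := (@uniform_on R G (generators_and_inverses s)).

(* [piece h] plays the role of the set of infinite reduced words beginning with
   the inverse of [h]; only its measure-theoretic shape is kept. *)
Definition boundary_motion (g h : L) : motion L k :=
  if h == g then Expand (next_letter g)
  else Contract (inv_letter g) (letter_digit r_gt1 (inv_letter g) h).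

Lemma boundary_motion_inv g :
  inverse_motions (boundary_motion g) (boundary_motion (inv_letter g)).
Proof.
move=> h; rewrite {1}/boundary_motion; case: eqP => [->|/eqP hg].
  move=> j; rewrite /boundary_motion (negbTE (next_letter_neq _ _)).
  by rewrite inv_letterK next_letterK.
exists (next_letter (inv_letter g)); first by rewrite /boundary_motion eqxx.
by rewrite letter_digitK // inv_letterK.
Qed.

(** All pieces have the same weight; a letter has density [k] on its own piece and [k^-1] on the
    others. The densities on a piece sum to [k + k * k^-1], and the terms [- ln] sum to
    [(k - 1) * ln k]. *)
Lemma stationary_max_entropy : exists (d : measure_display)
    (X : measurableType d) (a : measurable_action G X) (eta : probability X R),
  [/\ stationary mu a eta, ergodic a eta &
      furstenberg_entropy mu a eta =
      ((k%:R - 1) / (k%:R + 1) * ln k%:R)%:E].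
Proof.
have k1 := digits_gt1 r_gt1.
have kgt0 : 0 < k%:R :> R by rewrite ltr0n; exact: ltnW.
have k0 : k%:R != 0 :> R by rewrite gt_eqF.
have NE : (r * 2)%:R = k%:R + 1 :> R.
  by rewrite natr1 prednK //; move: r_gt1; lia.
have kS0 : k%:R + 1 != 0 :> R by rewrite gt_eqF // addr_gt0.
have w_ge0 (A : L) : 0 <= (r * 2)%:R^-1 :> R by rewrite invr_ge0.
have w_sum : \sum_(h : L) (r * 2)%:R^-1 * (if predT h then 1 else 0) = 1 :> R.
  rewrite (eq_bigr (fun=> (r * 2)%:R^-1)) => [|h _]; last by rewrite mulr1.
  by rewrite sumr_const card_letters -(mulr_natl _^-1) divff // NE.
have d01 : 0 <= (0 : R) <= 1 by rewrite lexx ler01.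
pose W := @Weights L R 0 (fun=> (r * 2)%:R^-1) predT w_ge0 w_sum d01.
pose v (g h : L) : R := if h == g then k%:R else k%:R^-1.
have v_bounds g h : k%:R^-1 <= v g h <= k%:R.
  have : k%:R^-1 <= k%:R :> R.
    by rewrite (@le_trans _ _ 1) ?invf_le1 ?ler1n // ltnW.
  by rewrite /v; case: ifP => _ kk; rewrite kk lexx.
have v_density g : motion_density W (boundary_motion g) (v g).
  move=> h; rewrite /boundary_motion /v; case: eqP => _ //=.
    by split=> // j; rewrite mulrC.
  by split=> //=; rewrite mulrAC mulVf // mul1r.
have v_sum h : \sum_g v g h = (r * 2)%:R.
  rewrite (bigD1 h) //= /v eqxx (eq_bigr (fun=> k%:R^-1)) => [|g gh].
    rewrite sumr_const cardC1 card_letters -(mulr_natl _^-1) divff // NE.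
  by rewrite eq_sym (negbTE gh).
pose x0 : L := (Ordinal (ltnW r_gt1), false).
exists _, (pieces x0 R), (piece_action hs k1 x0 0 boundary_motion_inv),
  (piece_measure W).
split.
- exact: (stationary_piece_action r_gt1 hs k1 boundary_motion_inv v_density v_sum).
- apply: (@ergodic_piece_action R G r s hs k1 L x0 0 W boundary_motion
    boundary_motion_inv predT (@next_letter r)).
  + by [].
  + move=> A j y _; exists (letter s A); rewrite piece_action_letter.
    by rewrite /move_points /boundary_motion /= eqxx digit_head_cons digit_tail_cons.
  (* There is a single level here, hence the index type [unit]. *)
  + move=> e eE A B _ _.
    apply: (@averaged_letter_const r r_gt1 R unit id (fun=> e) tt _ _ tt A tt B).
      by move=> [] []; exists 0%N.
    by move=> [] h; exact: eE.
  + by move=> A; right; left.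
- rewrite (entropy_piece_action r_gt1 hs k1 x0 boundary_motion_inv kgt0
    v_bounds v_density).
  congr EFin.
  rewrite (eq_bigr (fun=> (r * 2)%:R^-1 * ((k%:R - 1) * ln k%:R))) => [|h _].
    rewrite sumr_const card_letters -(mulr_natl (_ * _)) NE; field.
    by [].
  rewrite mulr1; congr (_ * _); rewrite (bigD1 h) //= /v eqxx.
  rewrite (eq_bigr (fun=> ln k%:R)) => [|g gh].
    rewrite sumr_const cardC1 card_letters -(mulr_natl (ln _)); ring.
  by rewrite eq_sym (negbTE gh) lnV ?posrE // opprK.
Qed.

End MaximalEntropy.

(** * The chain systems *)

Section ChainValues.
Context (R : realType) (a : R) (M : nat).
Hypotheses (a_gt1 : 1 < a) (M_gt0 : (0 < M)%N).

(* The masses solve [a * y i.+2 + y i = (a + 1) * y i.+1], the balance of one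
   neighbour at ratio [c i.+1] and [a] neighbours at ratio [(c i)^-1].  The slope
   closes up the chain: level [M.+1] has [a^-1] times the mass of level 0, and
   then level 0 is balanced when all but two of its ratios are 1. *)
Definition chain_slope : R := (a - 1) / (1 - a ^- M).
Definition chain_mass (i : nat) : R := 1 + chain_slope * a ^- i.
Definition chain_ratio (i : nat) : R := a * chain_mass i.+1 / chain_mass i.

Local Notation b := chain_slope.
Local Notation y := chain_mass.
Local Notation c := chain_ratio.

Let a_gt0 : 0 < a. Proof. exact: lt_trans a_gt1. Qed.
Let a_neq0 : a != 0. Proof. by rewrite gt_eqF. Qed.

Let aM_lt1 : a ^- M < 1.
Proof. by rewrite invf_lt1 ?exprn_gt0 // exprn_egt1 // -lt0n. Qed.

Lemma chain_slope_gt0 : 0 < b.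
Proof. by rewrite divr_gt0 // subr_gt0. Qed.

(** Being uniform in [M], this keeps the total mass of the chain within a constant of [M]. *)
Lemma chain_slope_le : b <= a.
Proof.
rewrite ler_pdivrMr ?subr_gt0 // mulrBr mulr1 lerD2l lerN2.
rewrite -(prednK M_gt0) exprS invfM mulrA divff // mul1r.
by rewrite invf_le1 ?exprn_gt0 // exprn_ege1 // ltW.
Qed.

Lemma chain_mass_gt0 i : 0 < y i.
Proof.
by rewrite addr_gt0 // mulr_gt0 ?chain_slope_gt0 // invr_gt0 exprn_gt0.
Qed.

Let y_neq0 i : y i != 0. Proof. by rewrite gt_eqF // chain_mass_gt0. Qed.

Lemma chain_massS i : a * y i.+1 = y i + (a - 1).
Proof.
have := expf_neq0 i a_neq0; rewrite /chain_mass exprS => ai0.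
by field; rewrite a_neq0 ai0.
Qed.

Lemma chain_mass_wrap : a * y M.+1 = y 0%N.
Proof.
have h : b * (1 - a ^- M) = a - 1.
  by rewrite /chain_slope divfK // subr_eq0 gt_eqF.
rewrite chain_massS /chain_mass expr0 invr1 mulr1; move: h.
by move: b (a ^- M) => u z h; lra.
Qed.

Lemma chain_mass0_double : a * y 1%N + y M = 2 * y 0%N.
Proof.
rewrite chain_massS; have : y M + (a - 1) = y 0%N.
  by rewrite -chain_massS chain_mass_wrap.
by move=> h; lra.
Qed.

Lemma chain_mass_sum : \sum_(i < M.+1) y i = M.+1%:R + y 0%N.
Proof.
have tel m : (a - 1) * (\sum_(i < m) y i) =
    (a - 1) * m%:R + a * y 0%N - a * y m.
  elim: m => [|m IH]; first by rewrite big_ord0; ring.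
  by rewrite big_ord_recr /= mulrDr IH chain_massS -natr1; ring.
have a1 : a - 1 != 0 by rewrite subr_eq0 gt_eqF.
by apply: (mulfI a1); rewrite tel chain_mass_wrap; ring.
Qed.

Lemma chain_ratio_bounds i : 1 <= c i <= a.
Proof.
have y0 := chain_mass_gt0 i; apply/andP; split.
  by rewrite ler_pdivlMr // mul1r chain_massS lerDl subr_ge0 ltW.
rewrite ler_pdivrMr // ler_pM2l // lerD2l ler_pM2l ?chain_slope_gt0 //.
by rewrite lef_pV2 ?posrE ?exprn_gt0 // ler_eXn2l.
Qed.

Lemma chain_ratio_gt0 i : 0 < c i.
Proof. by have /andP[+ _] := chain_ratio_bounds i; apply: lt_le_trans. Qed.

Lemma chain_ratioV i : (c i)^-1 = y i / (a * y i.+1).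
Proof. by rewrite invf_div. Qed.

Lemma chain_ratio_sum i : c i.+1 + a * (c i)^-1 = a + 1.
Proof.
have e : y i = a * y i.+1 - (a - 1) by rewrite chain_massS addrK.
rewrite chain_ratioV /chain_ratio chain_massS e.
by field; rewrite a_neq0 y_neq0.
Qed.

Lemma chain_ratio_sum0 : c 0%N + (c M)^-1 = 2.
Proof.
rewrite chain_ratioV chain_mass_wrap /chain_ratio -mulrDl chain_mass0_double.
by rewrite mulfK.
Qed.

(** The product of the ratios telescopes to [a ^ M.+1 * y M.+1 / y 0], which is [a ^ M] because the
    chain closes up. *)
Lemma sum_ln_chain_ratio : \sum_(i < M.+1) ln (c i) = M%:R * ln a.
Proof.
have tel m : \sum_(i < m) ln (c i) = m%:R * ln a + ln (y m) - ln (y 0%N).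
  elim: m => [|m IH]; first by rewrite big_ord0; ring.
  rewrite big_ord_recr /= IH /chain_ratio.
  rewrite lnM ?posrE ?invr_gt0 ?mulr_gt0 ?chain_mass_gt0 //.
  by rewrite lnV ?lnM ?posrE ?chain_mass_gt0 // -natr1; ring.
rewrite tel -chain_mass_wrap lnM ?posrE ?chain_mass_gt0 // -natr1; ring.
Qed.

(** After a cyclic shift of the first terms, [ln (c i)] has coefficient [a * y i.+1 - y i = a - 1],
    independent of [i]. *)
Lemma chain_entropy_sum : \sum_(i < M.+1)
  (y (ord_pred i).+1 * a * ln (c (ord_pred i)) - y i * ln (c i)) =
  (a - 1) * (M%:R * ln a).
Proof.
rewrite sumrB; have <- := reindex_inj (op := +%R) (@ord_pred_inj M.+1)
  (P := xpredT) (F := fun i : 'I_M.+1 => y i.+1 * a * ln (c i)).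
rewrite -sumrB -sum_ln_chain_ratio mulr_sumr; apply: eq_bigr => i _.
by rewrite -mulrBl [y _ * a]mulrC chain_massS; congr (_ * _); ring.
Qed.

End ChainValues.
Section ChainAction.
Context (R : realType) (G : groupType) (r : nat) (s : 'I_r -> G) (M n : nat)
  (delta : R).
Local Notation L := ('I_r * bool)%type.
Local Notation k := (r * 2).-1.
Local Notation P := ('I_M.+1 * L * 'I_n.+1)%type.
Hypotheses (r_gt1 : (1 < r)%N) (hs : freely_generates s) (M_gt0 : (0 < M)%N)
  (delta01 : 0 <= delta <= 1).
Local Notation mu := (@uniform_on R G (generators_and_inverses s)).

Let k_gt1 : (1 < k)%N. Proof. exact: digits_gt1. Qed.

(** All generators rotate upwards and all inverses downwards, so that inverse letters undo each
    other. *)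
Definition rotate_floor (g : L) (i : 'I_n.+1) : 'I_n.+1 :=
  if g.2 then ord_pred i else ordS i.

Lemma rotate_floorK g : cancel (rotate_floor g) (rotate_floor (inv_letter g)).
Proof.
move=> i; rewrite /rotate_floor /=.
by case: (g.2) => /=; [exact: ord_predK|exact: ordSK].
Qed.

(* The piece [(m, h, 0)] is a level of the chain pointing to [h]; levels are
   crossed by the letter [h], and level 0 is where the chain closes up.  The
   letters other than [h] and its inverse rotate a tower with floors
   [(0, h, i)] above the part of level 0 that lies below [delta]. *)
Definition chain_motion (g : L) (A : P) : motion P k :=
  let: (m, h, i) := A in
  if [&& m == ord0, h != g & h != inv_letter g] then
    Slide (fun low => (ord0, h, if low then rotate_floor g i else i))
  else if i != ord0 then Slide (fun=> A)
  else if h == g then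
    if m == ord_max then Slide (fun=> (ord0, h, ord0))
    else Expand (fun j => (ordS m, next_letter g j, ord0))
  else if m == ord0 then Slide (fun=> (ord_max, h, ord0))
  else Contract (ord_pred m, inv_letter g, ord0)
         (letter_digit r_gt1 (inv_letter g) h).

Let ordS_max : ordS (@ord_max M) = ord0.
Proof. by apply: val_inj; rewrite /= modnn. Qed.

Let ordS_eq0 (m : 'I_M.+1) : (ordS m == ord0) = (m == ord_max).
Proof. by rewrite -ordS_max (inj_eq (@ordS_inj _)). Qed.

Let max_eq0 : (@ord_max M == ord0) = false.
Proof. by rewrite -val_eqE /= gtn_eqF. Qed.

Lemma chain_motion_inv g :
  inverse_motions (chain_motion g) (chain_motion (inv_letter g)).
Proof.
have inv_neq l : (l == inv_letter l) = false.
  by rewrite eq_sym (negbTE (inv_letter_neq l)).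
move=> [[m h] i]; rewrite {1}/chain_motion; case: ifP => [|notower].
  move=> /and3P[/eqP-> hg hg'] low.
  exists (fun low' => (ord0, h, if low' then
    rotate_floor (inv_letter g) (if low then rotate_floor g i else i)
    else if low then rotate_floor g i else i)).
    by rewrite /chain_motion eqxx hg' inv_letterK hg.
  by case: low; rewrite ?rotate_floorK.
case: (eqVneq i ord0) notower => [->|i0] notower /=; last first.
  move=> low; exists (fun=> (m, h, i)) => //.
  by rewrite /chain_motion inv_letterK [(h != _) && _]andbC notower i0.
case: (eqVneq h g) notower => [->|hg] /= notower.
  case: (eqVneq m ord_max) => [->|mM].
    move=> low; exists (fun=> (ord_max, g, ord0)) => //.
    by rewrite /chain_motion inv_letterK !eqxx andbF /= inv_neq.
  move=> j; rewrite /chain_motion ordS_eq0 (negbTE mM) /=.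
  by rewrite (negbTE (next_letter_neq _ _)) inv_letterK ordSK next_letterK.
case: (eqVneq m ord0) notower => [->|m0] /= notower.
  move/negbFE/eqP: notower => -> low.
  exists (fun=> (ord0, inv_letter g, ord0)) => //.
  by rewrite /chain_motion max_eq0 /= !eqxx.
exists (fun j => (ordS (ord_pred m), next_letter (inv_letter g) j, ord0)).
  rewrite /chain_motion eqxx andbF /= -(inj_eq (@ordS_inj _)) ord_predK ordS_max.
  by rewrite (negbTE m0).
by rewrite ord_predK letter_digitK // inv_letterK.
Qed.

Local Notation a := (k%:R : R).
Local Notation y := (chain_mass a M).
Local Notation c := (chain_ratio a M).

Let a_gt1 : 1 < a. Proof. by rewrite ltr1n. Qed.
Let a_gt0 : 0 < a. Proof. exact: lt_trans a_gt1. Qed.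
Let y_gt0 i : 0 < y i. Proof. exact: chain_mass_gt0. Qed.
Let c_gt0 i : 0 < c i. Proof. exact: chain_ratio_gt0. Qed.

Let NE : (r * 2)%:R = a + 1.
Proof. by rewrite natr1 prednK //; move: r_gt1; lia. Qed.

(** The total mass before normalization: for each letter, [M.+1] levels and [n] further floors over
    the fraction [delta] of level 0. *)
Definition chain_norm : R :=
  (r * 2)%:R * (\sum_(m < M.+1) y m + y 0%N * n%:R * delta).

Lemma chain_norm_gt0 : 0 < chain_norm.
Proof.
have /andP[d0 _] := delta01.
rewrite /chain_norm mulr_gt0 //; first by rewrite NE addr_gt0.
rewrite ltr_pwDl //; last by rewrite !mulr_ge0 // ltW.
by rewrite big_ord_recl ltr_pwDl //; apply: sumr_ge0 => i _; exact: ltW.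
Qed.

(** The index type is a full product, so floors over levels other than 0 exist formally and get
    weight 0. *)
Definition chain_weight (A : P) : R :=
  if (A.1.1 == ord0) || (A.2 == ord0) then y A.1.1 / chain_norm else 0.

Definition chain_full (A : P) : bool := A.2 == ord0.

Lemma chain_weight_ge0 A : 0 <= chain_weight A.
Proof.
rewrite /chain_weight; case: ifP => // _.
by rewrite divr_ge0 // ltW // chain_norm_gt0.
Qed.

Lemma sum_chain (F : P -> R) (F0 : 'I_M.+1 -> R) (F1 : R) :
  (forall m h, F (m, h, ord0) = F0 m) ->
  (forall h i, i != ord0 -> F (ord0, h, i) = F1) ->
  (forall m h i, m != ord0 -> i != ord0 -> F (m, h, i) = 0) ->
  \sum_A F A = (r * 2)%:R * (\sum_m F0 m + n%:R * F1).
Proof.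
move=> FF0 FF1 FF.
have -> : \sum_A F A = \sum_h \sum_m \sum_i F (m, h, i).
  rewrite exchange_big /= pair_bigA /= pair_bigA /=.
  by apply: eq_bigr => -[[]].
rewrite (eq_bigr (fun=> \sum_m F0 m + n%:R * F1)).
  by rewrite sumr_const card_letters -(mulr_natl (_ + _)).
move=> h _.
rewrite (eq_bigr (fun m => F0 m + if m == ord0 then n%:R * F1 else 0)).
  by rewrite big_split /= -big_mkcond big_pred1_eq.
move=> m _; rewrite (bigD1 ord0) //= FF0; congr (_ + _).
case: eqVneq => [->|m0]; last by rewrite big1 // => i i0; rewrite FF.
rewrite (eq_bigr (fun=> F1)) => [|i i0]; last exact: FF1.
by rewrite sumr_const cardC1 card_ord -(mulr_natl F1).
Qed.

Lemma chain_weight_sum :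
  \sum_A chain_weight A * (if chain_full A then 1 else delta) = 1.
Proof.
rewrite (sum_chain (F0 := fun m => y m / chain_norm)
  (F1 := y 0%N / chain_norm * delta)).
- rewrite -mulr_suml (_ : _ + _ =
    (\sum_(m < M.+1) y m + y 0%N * n%:R * delta) / chain_norm); last by ring.
  by rewrite mulrA divff // gt_eqF // chain_norm_gt0.
- by move=> m h; rewrite /chain_weight /chain_full eqxx orbT mulr1.
- by move=> h i i0; rewrite /chain_weight /chain_full eqxx /= (negbTE i0).
- by move=> m h i m0 i0; rewrite /chain_weight /= (negbTE m0) (negbTE i0) mul0r.
Qed.

Definition chain_weights : weights P delta :=
  @Weights P R delta chain_weight chain_full chain_weight_ge0 chain_weight_sum
    delta01.

Definition chain_density (g : L) (A : P) : R :=
  let: (m, h, i) := A in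
  if [&& m == ord0, h != g & h != inv_letter g] || (i != ord0) then 1
  else if h == g then c m
  else (c (ord_pred m))^-1.

Let ord_predS (m : 'I_M.+1) : m != ord0 -> (ord_pred m).+1 = m :> nat.
Proof.
case: m => [[|m] mM] //= _.
by rewrite modnDr modn_small // ltnW.
Qed.

Let ord_pred0 : @ord_pred M.+1 ord0 = M :> nat.
Proof. by rewrite /= modn_small. Qed.

Let ordS_val (m : 'I_M.+1) : m != ord_max -> ordS m = m.+1 :> nat.
Proof.
rewrite -val_eqE /= => mM; rewrite modn_small // ltnS ltn_neqAle mM /=.
by rewrite -ltnS.
Qed.

Let mass_pred (m : 'I_M.+1) : y (ord_pred m).+1 * a = y m * (if m == ord0 then 1 else a).
Proof.
case: (eqVneq m ord0) => [->|m0]; last by rewrite ord_predS.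
by rewrite ord_pred0 mulrC chain_mass_wrap // mulr1.
Qed.

Let weight_level m h : chain_weight (m, h, ord0) = y m / chain_norm.
Proof. by rewrite /chain_weight eqxx orbT. Qed.

Let weight_floor h i : chain_weight (ord0, h, i) = y 0%N / chain_norm.
Proof. by rewrite /chain_weight eqxx. Qed.

Lemma chain_motion_density g :
  motion_density chain_weights (chain_motion g) (chain_density g).
Proof.
have y0 i : y i != 0 by rewrite gt_eqF.
have nz : chain_norm != 0 by rewrite gt_eqF // chain_norm_gt0.
have az : a != 0 by rewrite gt_eqF.
move=> [[m h] i]; rewrite /chain_motion /chain_density; case: ifP => [|notower].
  move=> /and3P[/eqP-> hg hg']; split=> // low.
  by rewrite mul1r [LHS]weight_floor [RHS]weight_floor.
case: (eqVneq i ord0) notower => [->|i0] notower; last first.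
  by split=> // low; rewrite mul1r.
case: (eqVneq h g) notower => [->|hg] notower.
  case: (eqVneq m ord_max) => [->|mM].
    split=> // low; rewrite [LHS]weight_level [X in _ = _ * X]weight_level.
    by rewrite -(chain_mass_wrap a_gt1 M_gt0) /chain_ratio; field; rewrite nz y0.
  split=> // j; split=> //.
  rewrite [X in X * _ = _]weight_level [X in _ = _ * X]weight_level ordS_val //.
  by rewrite /chain_ratio; field; rewrite nz y0.
case: (eqVneq m ord0) notower => [->|m0] notower.
  split=> // low; rewrite [LHS]weight_level [X in _ = _ * X]weight_level.
  rewrite ord_pred0 chain_ratioV chain_mass_wrap //.
  by field; rewrite nz y0.
split=> //; rewrite [LHS]weight_level [X in _ = _ * X * _]weight_level chain_ratioV.
by rewrite ord_predS //; field; rewrite nz y0 az.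
Qed.

Lemma chain_density_bounds g A : a^-1 <= chain_density g A <= a.
Proof.
have aV1 : a^-1 <= 1 by rewrite invf_le1 // ltW.
case: A => [[m h] i]; rewrite /chain_density; case: ifP => _.
  by rewrite aV1 ltW.
case: ifP => _.
  have /andP[c1 ca] := chain_ratio_bounds a_gt1 M_gt0 m.
  by rewrite ca (le_trans aV1).
have /andP[c1 ca] := chain_ratio_bounds a_gt1 M_gt0 (ord_pred m).
rewrite lef_pV2 ?posrE // ca /= (le_trans _ (ltW a_gt1)) //.
by rewrite invf_le1.
Qed.

(** One letter has ratio [c m]. The inverse ratio of the preceding level belongs to the [a] other
    letters, but on level 0 to the inverse letter alone; the remaining densities are 1 and disappear
    by [phi 1 = 0]. *)
Let sum_density (phi : R -> R) m h i : phi 1 = 0 ->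
  \sum_g phi (chain_density g (m, h, i)) =
  if i != ord0 then 0 else
  phi (c m) + (if m == ord0 then 1 else a) * phi (c (ord_pred m))^-1.
Proof.
move=> phi1; rewrite /chain_density; case: (eqVneq i ord0) => [_|i0] /=; last first.
  by rewrite big1 // => g _; rewrite orbT.
case: (eqVneq m ord0) => [->|m0] /=.
  rewrite (eq_bigr (fun g => (if g == h then phi (c 0%N) else 0) +
    if g == inv_letter h then phi (c (@ord_pred M.+1 ord0))^-1 else 0)).
    by rewrite big_split /= -!big_mkcond /= !big_pred1_eq mul1r.
  move=> g _; rewrite orbF [h == g]eq_sym; case: (eqVneq g h) => [->|gh] /=.
    by rewrite eq_sym (negbTE (inv_letter_neq h)) addr0.
  rewrite add0r -(can2_eq (@inv_letterK r) (@inv_letterK r)) eq_sym.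
  by case: eqP.
rewrite (bigD1 h) //= eqxx; congr (_ + _).
rewrite (eq_bigr (fun=> phi (c (ord_pred m))^-1)) => [|g gh].
  by rewrite sumr_const cardC1 card_letters -(mulr_natl (phi _)).
by rewrite eq_sym (negbTE gh).
Qed.

Lemma chain_density_sum A : \sum_g chain_density g A = (r * 2)%:R.
Proof.
case: A => [[m h] i]; apply/eqP; rewrite -subr_eq0 -[X in _ - X%:R]card_letters.
rewrite -sumr_const -sumrB (sum_density (phi := fun x => x - 1)) ?subrr //.
case: ifP => // _; case: (eqVneq m ord0) => [->|m0].
  rewrite ord_pred0 mul1r; have := chain_ratio_sum0 a_gt1 M_gt0.
  by move=> h2; apply/eqP; move: h2; lra.
have := chain_ratio_sum a_gt1 M_gt0 (ord_pred m); rewrite ord_predS //.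
by move=> h2; apply/eqP; move: h2; lra.
Qed.

Let p0 : P := (ord0, (Ordinal (ltnW r_gt1), false), ord0).

Definition chain_action : measurable_action G (pieces p0 R) :=
  piece_action hs k_gt1 p0 delta chain_motion_inv.

Lemma stationary_chain_action :
  stationary mu chain_action (piece_measure chain_weights).
Proof.
exact: (stationary_piece_action r_gt1 hs k_gt1 chain_motion_inv
  chain_motion_density chain_density_sum).
Qed.

(** The floors have density 1 and add nothing to the numerator, so [n] and [delta] enter only
    through [chain_norm]. *)
Lemma entropy_chain_action :
  furstenberg_entropy mu chain_action (piece_measure chain_weights) =
  ((a - 1) * (M%:R * ln a) / chain_norm)%:E.
Proof.
rewrite (entropy_piece_action r_gt1 hs k_gt1 p0 chain_motion_inv a_gt0
  chain_density_bounds chain_motion_density).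
congr EFin; have sumE m h i := @sum_density (fun x => - ln x) m h i.
rewrite (sum_chain (F0 := fun m : 'I_M.+1 => (y (ord_pred m).+1 * a *
  ln (c (ord_pred m)) - y m * ln (c m)) / chain_norm) (F1 := 0)).
- rewrite mulr0 addr0 -mulr_suml chain_entropy_sum // mulKf //.
  by rewrite NE gt_eqF // addr_gt0.
- move=> m h; rewrite sumE ?ln1 ?oppr0 //= /chain_weight /= /chain_full eqxx orbT.
  rewrite mass_pred lnV ?posrE // opprK mulr1.
  by move: (if _ then _ else _) (ln _) (ln _) => z l1 l2; ring.
- by move=> h i i0; rewrite sumE ?ln1 ?oppr0 //= i0 mulr0.
- by move=> m h i _ i0; rewrite sumE ?ln1 ?oppr0 //= i0 mulr0.
Qed.

(** The level reached when one digit has been stripped. From the top level the points first slide to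
    level 0 with all digits intact and then expand to level 1, so the levels 1 to [M] form a cycle
    that skips level 0. *)
Let next_level (m : 'I_M.+1) : 'I_M.+1 :=
  if m == ord_max then ordS ord0 else ordS m.

Let next_level_val (m : 'I_M.+1) :
  next_level m = (if m == M :> nat then 1 else m.+1)%N :> nat.
Proof.
have mE : (m == ord_max) = (m == M :> nat) by rewrite -val_eqE.
rewrite /next_level -mE; case: (eqVneq m ord_max) => [_|mM].
  by rewrite ordS_val // eq_sym max_eq0.
exact: ordS_val.
Qed.

Let iter_next_level (m : 'I_M.+1) t : (0 < m)%N ->
  iter t next_level m = ((m.-1 + t) %% M).+1 :> nat.
Proof.
move=> m0; have mM : (m <= M)%N by rewrite -ltnS.
elim: t => [|t IH].
  by rewrite /= addn0 modn_small; lia.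
rewrite iterS next_level_val IH.
set u := (m.-1 + t)%N; have uM : (u %% M < M)%N by rewrite ltn_mod.
have -> : (m.-1 + t.+1 = u + 1)%N by rewrite /u; lia.
case: eqP => [uE|uE].
  rewrite -modnDml (_ : u %% M + 1 = M)%N ?modnn //; lia.
by rewrite -modnDml [X in _ = X.+1]modn_small; lia.
Qed.

Let next_level_trans i j : exists t, iter t.+2 next_level i = next_level j.
Proof.
have pos m : (0 < next_level m)%N by rewrite next_level_val; case: ifP.
have le m : (next_level m <= M)%N by rewrite -ltnS.
(* One more than this is the distance from [next_level i] to [next_level j] in the cycle, up to
   multiples of [M]; adding [M] keeps the subtractions from truncating. *)
exists (next_level j + M - next_level i - 1)%N.
apply: val_inj; rewrite /= -!iterS iterSr iter_next_level //.
have ij : (((next_level i).-1 + (next_level j + M - next_level i - 1).+1) =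
  (next_level j).-1 + M)%N.
  by have := pos i; have := pos j; have := le i; lia.
rewrite ij modnDr modn_small; have := pos j; have := le j; lia.
Qed.

Let act_letter l (A : P) x : chain_action (letter s l) (A, x) =
  @move_points R k k_gt1 P p0 delta (chain_motion l) (A, x).
Proof. exact: piece_action_letter. Qed.

Lemma ergodic_chain_action : ergodic chain_action (piece_measure chain_weights).
Proof.
apply: (@ergodic_piece_action R G r s hs k_gt1 P p0 delta chain_weights
  chain_motion chain_motion_inv (fun A => A.2 == ord0)
  (fun A j => (next_level A.1.1, next_letter A.1.2 j, ord0))).
- by [].
- move=> [[m h] i] j x /eqP i0; have {i0}-> : i = ord0 by exact: i0.
  rewrite -/chain_action.
  have below m' : m' != ord_max -> chain_action (letter s h)
      ((m', h, ord0), digit_cons k_gt1 j x) = ((ordS m', next_letter h j, ord0), x).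
    move=> m'M; rewrite act_letter /move_points /chain_motion /=.
    rewrite !eqxx andbF (negbTE m'M) /=.
    by rewrite digit_head_cons digit_tail_cons.
  rewrite /next_level; case: (eqVneq m ord_max) => [->|mM]; last first.
    by exists (letter s h); exact: below.
  (* The first application of [h] slides the top level to level 0, the second expands it. *)
  exists (letter s h * letter s h)%g; rewrite actM.
  rewrite [X in chain_action _ X](_ : _ = ((ord0, h, ord0), digit_cons k_gt1 j x)).
    by apply: below; rewrite eq_sym max_eq0.
  by rewrite act_letter /move_points /chain_motion /= max_eq0 !eqxx.
- move=> e eE [[m h] i] [[m' h'] i'] /eqP /= -> /eqP /= ->.
  apply: (@averaged_letter_const r r_gt1 R _ next_level
    (fun m h => e (m, h, ord0)) ord0 next_level_trans).
  by move=> m1 h1; exact: eE.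
- move=> [[m h] i]; case: (eqVneq i ord0) => [->|i0]; first by right; left.
  case: (eqVneq m ord0) => [->|m0]; last first.
    by left; rewrite /= /chain_weight /= (negbTE m0) (negbTE i0).
  right; right; split; first exact/negbTE.
  exists (ord0, h, ord0) => // x xlow.
  (* Some inverse generator differs from [h] and its inverse; it lowers the floors over [delta] by
     one, so its powers bring floor [i] down to the core. *)
  have [l /and3P[l2 lh lh']] : exists l : L, [&& l.2, l != h & l != inv_letter h].
    have [l /andP[lh lh']] := exists_third_letter r_gt1 h (inv_letter h).
    case: (boolP l.2) => l2; first by exists l; rewrite l2 lh lh'.
    exists (inv_letter l); rewrite !(can2_eq (@inv_letterK r) (@inv_letterK r)).
    by rewrite inv_letterK lh lh' !andbT; exact: l2.
  have lh'' : h != inv_letter l.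
    by rewrite eq_sym (can2_eq (@inv_letterK r) (@inv_letterK r)).
  have down (i' : 'I_n.+1) : chain_action (letter s l) ((ord0, h, i'), x) =
      ((ord0, h, ord_pred i'), x).
    rewrite act_letter /move_points /chain_motion /= eq_sym lh lh'' /=.
    by rewrite xlow /rotate_floor l2.
  suff : forall t (i' : 'I_n.+1), i' = t :> nat ->
      exists g, chain_action g ((ord0, h, i'), x) = ((ord0, h, ord0), x).
    by move/(_ i i erefl).
  elim=> [|t IH] i' i't.
    by exists 1%g; rewrite act1 (_ : i' = ord0) //; apply: val_inj.
  have [|g gE] := IH (ord_pred i').
    rewrite /= i't addSn /= modnDr modn_small //.
    by have := ltn_ord i'; rewrite i't => /ltnW.
  by exists (g * letter s l)%g; rewrite actM down.
Qed.

End ChainAction.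

(** * Realizing every value of the entropy *)

Section PrescribedEntropy.
Context (R : realType) (G : groupType) (r : nat) (s : 'I_r -> G).
Local Notation k := (r * 2).-1.
Local Notation a := (k%:R : R).
Hypotheses (r_gt1 : (1 < r)%N) (hs : freely_generates s).
Local Notation mu := (@uniform_on R G (generators_and_inverses s)).

Let a_gt1 : 1 < a. Proof. by rewrite ltr1n digits_gt1. Qed.

Let NE : (r * 2)%:R = a + 1.
Proof. by rewrite natr1 prednK //; move: r_gt1; lia. Qed.

Definition trivial_action : measurable_action G unit :=
  MeasurableAction (fun x => erefl x) (fun _ _ x => erefl x)
    (fun _ => @measurable_id _ unit setT).

Lemma stationary_zero_entropy : exists (d : measure_display)
    (X : measurableType d) (b : measurable_action G X) (eta : probability X R),
  [/\ stationary mu b eta, ergodic b eta & furstenberg_entropy mu b eta = 0%E].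
Proof.
pose eta : probability unit R := \d_tt.
have translateE g E : translate trivial_action eta g E = eta E.
  by rewrite /translate image_id.
exists _, unit, trivial_action, eta; split.
- apply/(stationaryP r_gt1 hs) => E mE.
  under eq_bigr do rewrite translateE.
  rewrite sumr_const card_letters -(mulr_natl (fine _)) mulKf; last first.
    by rewrite NE gt_eqF // addr_gt0 // (lt_trans _ a_gt1).
  by rewrite fineK // fin_num_measure.
- move=> E _ _; rewrite /eta /= diracE.
  by case: (_ \in _); [right|left].
- rewrite (@entropy_of_density R G r s (ltnW r_gt1) hs _ _ _ eta (fun _ _ => 1) 1) //.
  + rewrite big1 ?mulr0 // => l _; rewrite ln1 oppr0.
    by rewrite Rintegral_cst // mul0r.
  + by move=> l x; rewrite invr1 lexx.
  + move=> l E mE; rewrite translateE.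
    by rewrite (integral_cst eta mE 1%E) mul1e.
Qed.

Lemma stationary_intermediate_entropy (t : R) :
  0 < t < (a - 1) / (a + 1) * ln a ->
  exists (d : measure_display) (X : measurableType d)
    (b : measurable_action G X) (eta : probability X R),
  [/\ stationary mu b eta, ergodic b eta & furstenberg_entropy mu b eta = t%:E].
Proof.
set h := _ * ln a; move=> /andP[t0 th].
have a0 : 0 < a by exact: lt_trans a_gt1.
have a10 : 0 < a + 1 by rewrite addr_gt0.
(* The total mass per letter of a chain without floors is at most [M + 2 + a], so this [M] makes its
   entropy at least [t]. *)
have [M M_gt0 tM] : exists2 M, (0 < M)%N & t * (M%:R + 2 + a) <= h * M%:R.
  exists (Num.truncn (t * (2 + a) / (h - t))).+1 => //.
  have := truncnS_gt (t * (2 + a) / (h - t)).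
  by rewrite ltr_pdivrMr ?subr_gt0 // => /ltW; lra.
pose y := chain_mass a M; pose Sy := \sum_(m < M.+1) y m.
have y0_gt0 : 0 < y 0%N by exact: chain_mass_gt0.
have Sy_le : Sy <= M%:R + 2 + a.
  rewrite /Sy chain_mass_sum // -natr1 /chain_mass expr0 invr1 mulr1.
  by have := chain_slope_le a_gt1 M_gt0; lra.
(* With [z = n * delta] the entropy is [h * M / (Sy + y 0 * z)]; this [z] makes it equal to [t]. *)
pose z := (h * M%:R / t - Sy) / y 0%N.
have z_ge0 : 0 <= z.
  apply: divr_ge0; last exact: ltW.
  rewrite subr_ge0 ler_pdivlMr // mulrC.
  by rewrite (le_trans _ tM) // ler_wpM2l // ltW.
(* Only the product [n * delta] matters, so any [n] above [z] serves, with [delta = z / n]. *)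
have [n zn] : exists n, z < n%:R.
  by exists (Num.truncn z).+1; exact: truncnS_gt.
have n0 : 0 < n%:R :> R by exact: le_lt_trans zn.
have delta01 : 0 <= z / n%:R <= 1.
  by rewrite divr_ge0 //= ler_pdivrMr // mul1r ltW.
exists _, _, (chain_action n (z / n%:R) r_gt1 hs M_gt0),
  (piece_measure (chain_weights n r_gt1 M_gt0 delta01)); split.
- exact: stationary_chain_action.
- exact: ergodic_chain_action.
- rewrite entropy_chain_action; congr EFin.
  have -> : chain_norm r M n (z / n%:R) = (a + 1) * (h * M%:R / t).
    rewrite /chain_norm NE -/y -/Sy; congr (_ * _).
    rewrite [y 0%N * n%:R * _](_ : _ = z * y 0%N); last first.
      by field; rewrite gt_eqF.
    by rewrite /z divfK ?gt_eqF // addrC subrK.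
  have M0 : 0 < M%:R :> R by rewrite ltr0n.
  have h0 : 0 < h by exact: lt_trans th.
  have -> : (a - 1) * (M%:R * ln a) = (a + 1) * (h * M%:R).
    by rewrite /h; field; rewrite gt_eqF.
  by field; rewrite !gt_eqF.
Qed.

End PrescribedEntropy.

Theorem theorem1p1 (R : realType) (G : groupType) (r : nat) (s : 'I_r -> G)
    (hr : (2 <= r)%N) (hs : freely_generates s) :
  let mu := @uniform_on R G (generators_and_inverses s) in
  exists hmax : R, is_max_entropy mu hmax%:E /\
    forall t : R, 0 <= t <= hmax ->
      exists (d : measure_display) (X : measurableType d)
        (a : measurable_action G X) (eta : probability X R),
        [/\ stationary mu a eta, ergodic a eta &
            furstenberg_entropy mu a eta = t%:E].
Proof.
move=> mu; pose q : R := (r * 2).-1%:R.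
have maximal := stationary_max_entropy R hr hs.
exists ((q - 1) / (q + 1) * ln q); split.
  split=> [|d X a eta st]; last exact: stationary_entropy_le st.
  by have [d [X [a [eta [st _ ent]]]]] := maximal; exists d, X, a, eta.
(* The endpoints come from the one-point space and from the maximal system; the choice of a chain
   divides by [t] and by [hmax - t]. *)
move=> t /andP[]; rewrite le_eqVlt => /orP[/eqP <- _|t0].
  exact: stationary_zero_entropy.
rewrite le_eqVlt => /orP[/eqP -> //|th].
by apply: stationary_intermediate_entropy => //; rewrite t0.
Qed.
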